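(* Consider the following instance and algorithm. Let $n\in\{4,6,8,\dots\}$, $m=1$, and $E=\{(i,i+1)\}_{i=1}^{n-1}\cup\{(i,n+1)\}_{i=1}^{n}$: the honest agents $1,\dots,n$ form a line and the single malicious agent $n+1$ is adjacent to every honest agent. There are $K=n$ arms with deterministic rewards ($\nu_k=\delta_{\mu_k}$), where $$\mu_1=1,\qquad \mu_k=\tfrac{13}{15}+\sum_{h=1}^{(n/2)-k}2^{-2^{h+1}}\ \ (2\le k\le n/2),\qquad \mu_k=0\ \ (k>n/2).$$ The honest agents run the multi-agent algorithm with the existing blocking rule, with $\alpha=4$, $\beta=2$, $\eta=2$, sticky sets of size $S=1$, and for every $i\in\{1+n/2,\dots,n\}$ the initial active set satisfies $\min S_1^{(i)}>n/2$. The malicious agent uses the following strategy: let $J_1=2^8$ and $J_{l+1}=(J_l+2)^2$ for $l\in\mathbb N$; if $j=J_l$ and $i\in\{l+1+n/2,\ l+2+n/2\}$ for some $l\in\{1,\dots,(n/2)-1\}$, it recommends $R_j^{(i)}=1-l+n/2$; otherwise it recommends some $R_j^{(i)}\in S_j^{(i)}$ such that $B_{j+1}^{(i)}=R_j^{(i)}$ (such an arm exists since rewards are deterministic and, when the recommendation is already active, $S_{j+1}^{(i)}=S_j^{(i)}$, so $B_{j+1}^{(i)}$ is a deterministic function of the information available at time $A_j$). Then there is an absolute constant $c>0$ such that for every such $n$ and every horizon $T\ge 2$, $$R_T^{(n)}\ \ge\ c\,\min\Big\{\log T+\exp\big(\exp(n/3)\big),\ \frac{T}{\log^7 T}\Bi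g\}.$$
   Context: Setting. $G=([n+m],E)$ is an undirected graph; agents $1,\dots,n$ are honest and $n+1,\dots,n+m$ malicious; $N(i)$ denotes the neighbors of $i$. There are $K$ arms; arm $k$ has reward distribution $\nu_k$ with mean $\mu_k$, and honest agent $i$ pulling arm $k$ at time $t$ receives $X_{i,t}(k)\sim\nu_k$, independent over $i,t,k$. Arms are labeled so that $\mu_1\ge\cdots\ge\mu_K$, and $\Delta_k=\mu_1-\mu_k$. The regret of honest agent $i$ is $R_T^{(i)}=\sum_{t=1}^T\mathbb E[\mu_1-\mu_{I_t^{(i)}}]$, where $I_t^{(i)}$ is the arm it pulls at time $t$. Algorithm (run by each honest $i$). Parameters $\alpha>0,\beta>1,\eta>1$, integer $S\le K-2$, sticky set $\hat S^{(i)}\subset[K]$ with $|\hat S^{(i)}|=S$. Let $A_0=0$, $A_j=\lceil j^\beta\rceil$; phase $j$ is the times $A_{j-1}+1,\dots,A_j$. In phase $j$ agent $i$ has active set $S_j^{(i)}=\hat S^{(i)}\cup\{U_j^{(i)},L_j^{(i)}\}$ with $U_j^{(i)}\neq L_j^{(i)}$ non-sticky arms; $S_1^{(i)}$ is an arbitrary such set. Let $T_k^{(i)}(t)$ be the number of pulls of $k$ by $i$ up to time $t$ and $\hat\mu_k^{(i)}(t)$ their empirical mean. At each time $t$ in phase $j$, $i$ pulls $I_t^{(i)}\in\arg\max_{k\in S_j^{(i)}}\big(\hat\mu_k^{(i)}(t-1)+\sqrt{\alpha\log t/T_k^{(i)}(t-1)}\big)$ (index $+\infty$ if $T_k^{(i)}(t-1)=0$;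 ties broken by a fixed deterministic rule). At $t=A_j$: (1) $B_j^{(i)}\in\arg\max_{k\in S_j^{(i)}}(T_k^{(i)}(A_j)-T_k^{(i)}(A_{j-1}))$ (most played active arm in the phase); (2) the blocklists $P_{j'}^{(i)}\subset[n+m]$ ($j'\ge j$; initially all empty) are updated by the blocking rule; (3) $H_j^{(i)}$ is drawn uniformly at random from $N(i)\setminus P_j^{(i)}$; if $H_j^{(i)}\le n$ then $R_j^{(i)}=B_j^{(H_j^{(i)})}$, otherwise $R_j^{(i)}\in[K]$ is chosen by the malicious agent; (4) if $R_j^{(i)}\notin S_j^{(i)}$, set $U_{j+1}^{(i)}\in\arg\max_{k\in\{U_j^{(i)},L_j^{(i)}\}}(T_k^{(i)}(A_j)-T_k^{(i)}(A_{j-1}))$, $L_{j+1}^{(i)}=R_j^{(i)}$, $S_{j+1}^{(i)}=\hat S^{(i)}\cup\{U_{j+1}^{(i)},L_{j+1}^{(i)}\}$; otherwise $S_{j+1}^{(i)}=S_j^{(i)}$. Existing blocking rule: at phase $j>1$, if $B_j^{(i)}\neq R_{j-1}^{(i)}$, then $H_{j-1}^{(i)}$ is added to $P_{j'}^{(i)}$ for all $j'\in\{j,\dots,\lceil j^\eta\rceil\}$. *)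

(* Defs.v *)
From mathcomp Require Import all_boot all_order all_algebra.
From mathcomp Require Import reals exp.
Set Implicit Arguments. Unset Strict Implicit. Unset Printing Implicit Defensive.
Import Order.TTheory GRing.Theory Num.Theory.
Local Open Scope ring_scope.

(* Arms are 'I_K (0-based: arm k of the paper is the ordinal k-1).           *)
Section Phase.
Context {R : realType} (K : nat).
Variable mu : 'I_K -> R.          (* reward of arm k: X_{i,t}(k) = mu k      *)
Variable alpha : R.
Variable A : nat -> nat.          (* A j = end time of phase j, A 0 = 0      *)
Variable tb : {set 'I_K} -> 'I_K. (* fixed deterministic tie-breaking rule   *)

Definition argmax_R (S : {set 'I_K}) (f : 'I_K -> R) : {set 'I_K} :=
  [set k in S | [forall k' in S, f k' <= f k]].

Definition argmax_nat (S : {set 'I_K}) (f : 'I_K -> nat) : {set 'I_K} :=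
  [set k in S | [forall k' in S, (f k' <= f k)%N]].

(* UCB arm choice at time t: arms with zero pulls have index +oo. *)
Definition ucb_choice (t : nat) (S : {set 'I_K})
    (c : {ffun 'I_K -> nat}) (s : {ffun 'I_K -> R}) : 'I_K :=
  let Z := [set k in S | c k == 0%N] in
  if Z != set0 then tb Z
  else tb (argmax_R S (fun k => s k / (c k)%:R
                               + Num.sqrt (alpha * ln (t%:R) / (c k)%:R))).

Fixpoint run_phase (ts : seq nat) (S : {set 'I_K})
    (c : {ffun 'I_K -> nat}) (s : {ffun 'I_K -> R})
    : seq 'I_K * {ffun 'I_K -> nat} * {ffun 'I_K -> R} :=
  match ts with
  | [::] => ([::], c, s)
  | t :: ts' =>
      let k := ucb_choice t S c s in
      let c' := [ffun k' => if k' == k then (c k').+1 else c k'] in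
      let s' := [ffun k' => if k' == k then s k' + mu k else s k'] in
      let: (ps, c'', s'') := run_phase ts' S c' s' in (k :: ps, c'', s'')
  end.

Definition phase_times (j : nat) : seq nat := iota (A j.-1).+1 (A j - A j.-1).

Definition most_played (S : {set 'I_K}) (c0 c1 : {ffun 'I_K -> nat}) : 'I_K :=
  tb (argmax_nat S (fun k => c1 k - c0 k)%N).

End Phase.

(* The multi-agent process. Nodes 'I_(n+m): honest agents are lshift m i,   *)
(* i : 'I_n; malicious ones are rshift n q, q : 'I_m.                       *)
Record lstate (R : realType) (K N : nat) := LS {
  l_cnt : {ffun 'I_K -> nat};      (* T_k(A_{j-1}) *)
  l_sm  : {ffun 'I_K -> R};        (* sum of rewards of arm k up to A_{j-1} *)
  l_U   : 'I_K;
  l_L   : 'I_K;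
  l_bu  : {ffun 'I_N -> nat};      (* node k lies in P_{j'} iff j' <= l_bu k *)
  l_pH  : option 'I_N;             (* H_{j-1} *)
  l_pR  : option 'I_K              (* R_{j-1} *)
}.

Section Process.
Context {R : realType} (n m K : nat).
Variable mu : 'I_K -> R.
Variable gap : 'I_K -> R.         (* Delta_k = mu_1 - mu_k *)
Variable alpha : R.
Variable A : nat -> nat.          (* phase ends A_j = ceil (j^beta) *)
Variable blockend : nat -> nat.   (* ceil (j^eta) *)
Variable adj : rel 'I_(n+m).
Variable tb : {set 'I_K} -> 'I_K.
Variable hatS : 'I_n -> {set 'I_K}.
(* malicious recommendation, given the phase j, the honest agent i asking,
   the malicious agent q, and i's counts / reward sums at A_j and S_j^{(i)} *)
Variable mal : nat -> 'I_n -> 'I_m -> {ffun 'I_K -> nat} ->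
               {ffun 'I_K -> R} -> {set 'I_K} -> 'I_K.

Notation st := (lstate R K (n+m)).

Definition active (i : 'I_n) (U L : 'I_K) : {set 'I_K} := hatS i :|: [set U; L].

Definition act_of (i : 'I_n) (ls : st) := active i (l_U ls) (l_L ls).

Definition phase_out (j : nat) (i : 'I_n) (ls : st) :=
  run_phase mu alpha tb (phase_times A j) (act_of i ls) (l_cnt ls) (l_sm ls).

Definition Bj (j : nat) (i : 'I_n) (ls : st) : 'I_K :=
  most_played tb (act_of i ls) (l_cnt ls) (phase_out j i ls).1.2.

Definition bu_upd (j : nat) (i : 'I_n) (ls : st) : {ffun 'I_(n+m) -> nat} :=
  match l_pH ls, l_pR ls with
  | Some h, Some r =>
      if (1 < j)%N && (Bj j i ls != r)
      then [ffun k => if k == h then maxn (l_bu ls k) (blockend j) else l_bu ls k]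
      else l_bu ls
  | _, _ => l_bu ls
  end.

Definition nbrs (i : 'I_n) : {set 'I_(n+m)} := [set k | adj (lshift m i) k].

Definition cand (j : nat) (i : 'I_n) (ls : st) : {set 'I_(n+m)} :=
  let C := nbrs i :\: [set k | (j <= bu_upd j i ls k)%N] in
  if C != set0 then C else nbrs i.

Definition recom (j : nat) (gs : 'I_n -> st) (i : 'I_n) (h : 'I_(n+m)) : 'I_K :=
  match split h with
  | inl i' => Bj j i' (gs i')
  | inr q => mal j i q (phase_out j i (gs i)).1.2 (phase_out j i (gs i)).2
                 (act_of i (gs i))
  end.

Definition next_ls (j : nat) (gs : 'I_n -> st) (i : 'I_n) (h : 'I_(n+m)) : st :=
  let ls := gs i in
  let c1 := (phase_out j i ls).1.2 in
  let r := recom j gs i h in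
  let S := act_of i ls in
  let '(U', L') :=
     if r \notin S then
       (tb (argmax_nat [set l_U ls; l_L ls] (fun k => c1 k - l_cnt ls k)%N), r)
     else (l_U ls, l_L ls) in
  LS c1 (phase_out j i ls).2 U' L' (bu_upd j i ls) (Some h) (Some r).

Definition phase_cost (T : nat) (j : nat) (a : 'I_n) (ls : st) : R :=
  \sum_(p <- zip (phase_times A j) (phase_out j a ls).1.1 | (p.1 <= T)%N) gap p.2.

Definition draw_prob (j : nat) (gs : 'I_n -> st) (h : {ffun 'I_n -> 'I_(n+m)}) : R :=
  \prod_(i : 'I_n)
     (if h i \in cand j i (gs i) then (#|cand j i (gs i)|%:R)^-1 else 0).

(* expected regret of agent a over times t <= T, from the start of phase j
   with global state gs, processing [fuel] further phases *)
Fixpoint exp_cost (T : nat) (a : 'I_n) (fuel j : nat) (gs : 'I_n -> st) : R :=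
  phase_cost T j a (gs a) +
  match fuel with
  | 0 => 0
  | f.+1 => \sum_(h : {ffun 'I_n -> 'I_(n+m)})
              draw_prob j gs h * exp_cost T a f j.+1 (fun i => next_ls j gs i (h i))
  end.

Definition init_state (U0 L0 : 'I_n -> 'I_K) (i : 'I_n) : st :=
  LS [ffun => 0%N] [ffun => 0] (U0 i) (L0 i) [ffun => 0%N] None None.

(* R_T^{(a)} = sum_{t=1}^T E[mu_1 - mu_{I_t^{(a)}}]; phases 1..T+1 cover all
   times <= T since A_j >= j. *)
Definition regret (U0 L0 : 'I_n -> 'I_K) (a : 'I_n) (T : nat) : R :=
  exp_cost T a T 1 (init_state U0 L0).

End Process.

(* The instance of the theorem: n honest agents on a line, m = 1 malicious  *)
(* agent (node index n, i.e. agent n+1) adjacent to all; K = n arms.         *)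
(* 0-based: honest agent i of the paper is ordinal i-1, arm k is k-1.        *)
Section Instance.
Context {R : realType} (n : nat).

Definition inst_adj : rel 'I_(n + 1) := fun u v =>
  [&& (val u < n)%N, (val v < n)%N & ((val u).+1 == val v) || ((val v).+1 == val u)]
  || ((val u < n)%N && (val v == n)) || ((val v < n)%N && (val u == n)).

Definition inst_mu (x : 'I_n) : R :=
  let k := (val x).+1 in
  if k == 1%N then 1
  else if (k <= n./2)%N then
    13%:R / 15%:R + \sum_(1 <= h < (n./2 - k).+1) ((2 ^ (2 ^ h.+1))%:R)^-1
  else 0.

Definition inst_gap (x : 'I_n) : R := 1 - inst_mu x.

(* J_1 = 2^8, J_{l+1} = (J_l + 2)^2 (J 0 is unused) *)
Fixpoint Jseq (l : nat) : nat :=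
  match l with
  | 0 => 0
  | 1 => 2 ^ 8
  | l'.+1 => (Jseq l' + 2) ^ 2
  end.

Definition inst_A (j : nat) : nat := j ^ 2.         (* ceil (j^beta), beta = 2 *)
Definition inst_blockend (j : nat) : nat := j ^ 2.  (* ceil (j^eta),  eta = 2  *)
Definition inst_alpha : R := 4%:R.

Definition inst_mal (tb : {set 'I_n} -> 'I_n) (j : nat) (i : 'I_n) (q : 'I_1)
    (c : {ffun 'I_n -> nat}) (s : {ffun 'I_n -> R}) (S : {set 'I_n}) : 'I_n :=
  (* the arm B_{j+1}^{(i)} that i would find most played in phase j+1 if
     S_{j+1}^{(i)} = S_j^{(i)} *)
  let Bnext := most_played tb S c
      (run_phase inst_mu inst_alpha tb (phase_times inst_A j.+1) S c s).1.2 in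
  match [pick l : 'I_n | [&& (1 <= val l)%N, (val l < n./2)%N, j == Jseq l &
            ((val i).+1 == val l + 1 + n./2) || ((val i).+1 == val l + 2 + n./2)]] with
  | Some l => insubd Bnext (n./2 - val l)%N   (* arm 1 - l + n/2 *)
  | None => Bnext
  end.

Definition inst_regret (tb : {set 'I_n} -> 'I_n) (hatS : 'I_n -> {set 'I_n})
    (U0 L0 : 'I_n -> 'I_n) (a : 'I_n) (T : nat) : R :=
  regret (m := 1) inst_mu inst_gap inst_alpha inst_A inst_blockend inst_adj tb hatS
         (inst_mal tb) U0 L0 a T.

End Instance.

(* Main.v *)
Require Import Defs.
From mathcomp Require Import all_boot all_order all_algebra.
From mathcomp Require Import reals sequences exp.
From mathcomp Require Import zify ring lra.
Set Implicit Arguments. Unset Strict Implicit. Unset Printing Implicit Defensive.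
Import Order.TTheory GRing.Theory Num.Theory.
Local Open Scope ring_scope.

(** Write h = n/2. With 0-based indices, call the arm h - l "of rank l" (arms
    >= h, of mean 0, have rank at most 0; the best arm has rank h). The right
    half of the line starts with arms of rank <= 0 only, so arm 0 can reach the
    last agent only by travelling through agents h, h+1, ..., n-1.

    At phase J_l the malicious agent hands the rank-l arm to agents h+l and
    h+l+1. It beats every arm of smaller rank by a margin of about J_l^(-1/4),
    so from phase J_l + 1 on it is the most played arm of an agent that knows
    no arm of larger rank, and such an agent never blocks the malicious one. If
    agent h+l contacts agent h+l-1 in phase J_l + 1, it is recommended an arm
    of rank < l, which it does not play most, and blocks agent h+l-1 until
    phase (J_l + 2)^2 = J_(l+1). During this period arm 0 cannot pass beyond
    agent h+l-1, even if that agent has learned it. Conversely, no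
    block put on agent h+l by agent h+l+1 outlasts J_(l+1), as both play the
    rank-l arm most in this period, so the step can be repeated at J_(l+1).

    Each level costs three prescribed draws of probability at least 1/3, and
    keeping agents h and h+1 in contact with the malicious agent until phase
    J_1 costs another absolute constant. With probability at least c 27^(-L)
    the last agent thus pays a constant gap at each time t <= J_(L+1)^2, where
    J_L^2 >= 2^(2^(L+3)). The log T term comes from the sticky arm, which has
    mean 0 and is explored logarithmically often along every trajectory. *)

(** * UCB within one phase *)

Section UCB.
Context {R : realType} (K : nat) (mu : 'I_K -> R) (alpha : R).
Context (tb : {set 'I_K} -> 'I_K).
Hypothesis tbP : forall X : {set 'I_K}, X != set0 -> tb X \in X.

Implicit Types (S : {set 'I_K}) (c : {ffun 'I_K -> nat}) (s : {ffun 'I_K -> R}).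

Lemma argmax_nat_neq0 (S : {set 'I_K}) (f : 'I_K -> nat) :
  S != set0 -> argmax_nat S f != set0.
Proof.
case/set0Pn => x xS; apply/set0Pn.
case: (@arg_maxnP _ x (mem S) f xS) => k kS kmax.
exists k; rewrite inE; apply/andP; split=> //.
by apply/forall_inP => k' /kmax.
Qed.

Lemma argmax_R_neq0 (S : {set 'I_K}) (f : 'I_K -> R) :
  S != set0 -> argmax_R S f != set0.
Proof.
case/set0Pn => x xS; apply/set0Pn.
case: (@arg_maxP _ _ _ x (mem S) f xS) => k kS kmax.
exists k; rewrite inE; apply/andP; split=> //.
by apply/forall_inP => k' /kmax.
Qed.

Lemma tb_argmax_nat (S : {set 'I_K}) (f : 'I_K -> nat) : S != set0 ->
  tb (argmax_nat S f) \in S /\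
  forall k, k \in S -> (f k <= f (tb (argmax_nat S f)))%N.
Proof.
move=> /(argmax_nat_neq0 f)/tbP; rewrite inE => /andP[-> /forall_inP H].
by split.
Qed.

Lemma tb_argmax_nat_eq (S : {set 'I_K}) (f : 'I_K -> nat) (a : 'I_K) :
  a \in S -> (forall k, k \in S -> k != a -> (f k < f a)%N) ->
  tb (argmax_nat S f) = a.
Proof.
move=> aS lt_a; have S0 : S != set0 by apply/set0Pn; exists a.
have [bS bmax] := tb_argmax_nat f S0.
apply/eqP/negPn/negP => /(lt_a _ bS); rewrite ltnNge => /negP; apply.
exact: bmax.
Qed.

Lemma ucb_choice_in t S c s :
  S != set0 -> ucb_choice alpha tb t S c s \in S.
Proof.
move=> S0; rewrite /ucb_choice; case: ifPn => [/tbP|_].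
  by rewrite inE => /andP[].
by have /tbP := argmax_R_neq0
  (fun k => s k / (c k)%:R + Num.sqrt (alpha * ln (t%:R) / (c k)%:R)) S0;
  rewrite inE => /andP[].
Qed.

Definition incr_count (k : 'I_K) (c : {ffun 'I_K -> nat}) : {ffun 'I_K -> nat} :=
  [ffun k' => if k' == k then (c k').+1 else c k'].

Definition add_reward (k : 'I_K) (s : {ffun 'I_K -> R}) : {ffun 'I_K -> R} :=
  [ffun k' => if k' == k then s k' + mu k else s k'].

Notation run := (run_phase mu alpha tb).

Lemma run_phase_cons t ts S c s :
  let k := ucb_choice alpha tb t S c s in
  let o := run ts S (incr_count k c) (add_reward k s) in
  run (t :: ts) S c s = (k :: o.1.1, o.1.2, o.2).
Proof. by rewrite /= -/(incr_count _ _) -/(add_reward _ _); case: (run _ _ _ _) => [[]]. Qed.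

Lemma size_run_phase ts S c s : size (run ts S c s).1.1 = size ts.
Proof.
by elim: ts c s => // t ts IH c s; rewrite run_phase_cons /= IH.
Qed.

Lemma run_phase_in ts S c s :
  S != set0 -> {subset (run ts S c s).1.1 <= S}.
Proof.
move=> S0; elim: ts c s => // t ts IH c s k; rewrite run_phase_cons /= inE.
by case/orP => [/eqP -> | /IH //]; exact: ucb_choice_in.
Qed.

Lemma run_phase_count ts S c s k :
  (run ts S c s).1.2 k = (c k + count_mem k (run ts S c s).1.1)%N.
Proof.
elim: ts c s => [|t ts IH] c s; first by rewrite addn0.
rewrite run_phase_cons /= IH ffunE eq_sym; case: eqP => _ /=; lia.
Qed.

Lemma run_phase_le ts S c s k : (c k <= (run ts S c s).1.2 k)%N.
Proof. by rewrite run_phase_count leq_addr. Qed.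

Lemma run_phase_sum ts S c s : S != set0 ->
  (\sum_(k in S) ((run ts S c s).1.2 k - c k) = size ts)%N.
Proof.
move=> S0; rewrite -(size_run_phase ts S c s).
under eq_bigr do rewrite run_phase_count addKn.
have := @run_phase_in ts S c s S0.
elim: (run ts S c s).1.1 => [|x xs IH] sub; first by rewrite big1.
rewrite /= big_split /= IH; last by move=> y ys; apply: sub; rewrite inE ys orbT.
rewrite (bigD1 x) /=; last by apply: sub; rewrite mem_head.
rewrite eqxx big1 ?addn0 ?add1n // => k /andP[_ kx].
by rewrite eq_sym (negbTE kx).
Qed.

(** Each pull yields exactly the mean, so the empirical mean of a pulled arm is always [mu k]. *)
Lemma run_phase_mean ts S c s :
  (forall k, s k = mu k * (c k)%:R) ->
  forall k, (run ts S c s).2 k = mu k * ((run ts S c s).1.2 k)%:R.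
Proof.
elim: ts c s => [|t ts IH] c s mean k //; rewrite run_phase_cons /=.
apply: IH => {}k; rewrite !ffunE; case: eqP => [->|_] //.
by rewrite mean -natr1 mulrDr mulr1.
Qed.

(** The witness is the state just before the last pull of [k], where the UCB rule can be read off
    with counts between the initial and final ones. *)
Lemma last_pull ts S c s k :
  (forall k, s k = mu k * (c k)%:R) -> (c k < (run ts S c s).1.2 k)%N ->
  exists t c' s', [/\ t \in ts,
    forall k', (c k' <= c' k' <= (run ts S c s).1.2 k')%N,
    (c' k).+1 = (run ts S c s).1.2 k,
    forall k', s' k' = mu k' * (c' k')%:R &
    ucb_choice alpha tb t S c' s' = k].
Proof.
elim: ts c s => [|t ts IH] c s mean; first by rewrite ltnn.
rewrite run_phase_cons /=; set x := ucb_choice _ _ _ _ _ _.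
have mean' k' : add_reward x s k' = mu k' * (incr_count x c k')%:R.
  by rewrite !ffunE; case: eqP => [->|_] //; rewrite mean -natr1 mulrDr mulr1.
have le_incr k' : (c k' <= incr_count x c k')%N by rewrite ffunE; case: eqP.
have le_run := run_phase_le ts S (incr_count x c) (add_reward x s).
case: (ltnP (incr_count x c k) ((run ts S (incr_count x c) (add_reward x s)).1.2 k)) =>
  [lt|ge] lt_ck.
  have [t' [c' [s' [tts bnd ck ms ch]]]] := IH _ _ mean' lt.
  exists t', c', s'; split=> //; first by rewrite inE tts orbT.
  by move=> k'; have /andP[l1 ->] := bnd k'; rewrite (leq_trans (le_incr k') l1).
exists t, c, s; split=> //; first by rewrite mem_head.
- by move=> k'; rewrite leqnn (leq_trans (le_incr k') (le_run k')).
- apply/eqP; rewrite eqn_leq lt_ck /= (leq_trans ge) // ffunE.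
  by case: eqP.
- move: ge lt_ck; rewrite ffunE; case: eqP => [-> //|_] ge lt_ck.
  by move: (leq_trans lt_ck ge); rewrite ltnn.
Qed.

(** At a zero count the division gives bonus 0 instead of an infinite one, hence the positivity
    conditions that accompany this index. *)
Definition ucb_index (t : nat) (c : {ffun 'I_K -> nat}) (k : 'I_K) : R :=
  mu k + Num.sqrt (alpha * ln (t%:R) / (c k)%:R).

(* The first alternative is a pull of an arm of infinite index. *)
Lemma last_pull_index ts S c s k :
  (forall k, s k = mu k * (c k)%:R) -> S != set0 ->
  (c k < (run ts S c s).1.2 k)%N ->
  (run ts S c s).1.2 k = 1%N \/
  exists t c', [/\ t \in ts,
    forall k', (c k' <= c' k' <= (run ts S c s).1.2 k')%N,
    (c' k).+1 = (run ts S c s).1.2 k,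
    (0 < c' k)%N &
    forall k', k' \in S -> (0 < c' k')%N /\ ucb_index t c' k' <= ucb_index t c' k].
Proof.
move=> mean S0 /(last_pull mean)[t [c' [s' [tts bnd ck ms]]]].
rewrite /ucb_choice; case: ifPn => [/tbP tbZ|/negPn/eqP Z0] def_k.
  by left; move: tbZ; rewrite def_k inE -ck => /andP[_ /eqP ->].
have pos k' : k' \in S -> (0 < c' k')%N.
  move=> k'S; rewrite lt0n; apply/negP => c0.
  by have := in_set0 k'; rewrite -Z0 inE k'S c0.
have /tbP := argmax_R_neq0
  (fun k => s' k / (c' k)%:R + Num.sqrt (alpha * ln (t%:R) / (c' k)%:R)) S0.
rewrite def_k inE => /andP[kS /forall_inP kmax].
right; exists t, c'; split=> // [|k' k'S]; first exact: pos.
split; first exact: pos.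
have := kmax _ k'S; rewrite !ms /ucb_index !mulfK //.
  by rewrite pnatr_eq0 -lt0n pos.
by rewrite pnatr_eq0 -lt0n pos.
Qed.

(** At its last pull [k] had an index at least that of [a], so its bonus was at least [delta];
    squaring bounds its count before that pull. *)
Lemma suboptimal_pulls ts S c s (a k : 'I_K) (delta lam : R) :
  (forall k, s k = mu k * (c k)%:R) -> a \in S -> 0 <= alpha ->
  0 < delta -> mu k + delta <= mu a ->
  0 <= lam -> (forall t, t \in ts -> ln (t%:R : R) <= lam) ->
  (((run ts S c s).1.2 k - c k)%N)%:R <= 1 + alpha * lam / delta ^+ 2.
Proof.
move=> mean aS alpha0 delta0 gap lam0 lnle.
have S0 : S != set0 by apply/set0Pn; exists a.
have d20 : 0 < delta ^+ 2 by rewrite exprn_gt0.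
have rhs0 : 0 <= alpha * lam / delta ^+ 2.
  by apply: divr_ge0 (ltW d20); exact: mulr_ge0.
set o := (run ts S c s).1.2.
have [le|lt] := leqP (o k) (c k).
  by move: le; rewrite -subn_eq0 => /eqP ->; rewrite addr_ge0.
have ok : ((o k - c k)%N)%:R <= (o k)%:R :> R by rewrite ler_nat leq_subr.
apply: (le_trans ok).
have [->|[t [c' [tts bnd ck ck0 idx]]]] := last_pull_index mean S0 lt.
  by rewrite lerDl.
rewrite /o -ck -natr1 addrC lerD2l.
have [_] := idx _ aS; rewrite /ucb_index => le.
set x := alpha * ln t%:R / (c' k)%:R in le *.
have dx : delta <= Num.sqrt x.
  have := sqrtr_ge0 (alpha * ln t%:R / (c' a)%:R); lra.
have x0 : 0 < x by rewrite -sqrtr_gt0; exact: lt_le_trans dx.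
have : delta ^+ 2 <= x.
  rewrite -(sqr_sqrtr (ltW x0)) ler_pXn2r // ?nnegrE ?sqrtr_ge0 //.
  exact: ltW.
have ckR : 0 < (c' k)%:R :> R by rewrite ltr0n.
rewrite /x ler_pdivlMr // => le2.
rewrite ler_pdivlMr // mulrC; apply: (le_trans le2).
by rewrite ler_wpM2l // lnle.
Qed.

(** Otherwise some other arm is pulled at least as often as [a], so every increment is at most [Y]
    and three arms cannot fill the phase. *)
Lemma dominating_arm ts S c s (a : 'I_K) (Y : R) :
  a \in S -> (#|S| <= 3)%N ->
  (forall k, k \in S -> k != a -> (((run ts S c s).1.2 k - c k)%N)%:R <= Y) ->
  3%:R * Y < (size ts)%:R ->
  forall k, k \in S -> k != a ->
    ((run ts S c s).1.2 k - c k < (run ts S c s).1.2 a - c a)%N.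
Proof.
move=> aS S3 bnd big k kS ka; rewrite ltnNge; apply/negP => le.
have S0 : S != set0 by apply/set0Pn; exists a.
have allY k' : k' \in S -> (((run ts S c s).1.2 k' - c k')%N)%:R <= Y.
  move=> k'S; have [->|/bnd] := eqVneq k' a; last exact.
  by apply: le_trans (bnd _ kS ka); rewrite ler_nat.
have Y0 : 0 <= Y by apply: le_trans (allY _ aS); rewrite ler0n.
move: big; rewrite -(run_phase_sum ts c s S0) natr_sum ltNge => /negP; apply.
apply: (@le_trans _ _ (\sum_(k' in S) Y)); first exact: ler_sum.
rewrite sumr_const -[Y *+ _]mulr_natl.
by apply: ler_wpM2r => //; rewrite ler_nat.
Qed.

End UCB.

(** * Draws and expected cost *)

Section MultiAgent.
Context {R : realType} (n m K : nat) (mu gap : 'I_K -> R) (alpha : R).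
Context (A blockend : nat -> nat) (adj : rel 'I_(n + m)).
Context (tb : {set 'I_K} -> 'I_K) (hatS : 'I_n -> {set 'I_K}).
Context (mal : nat -> 'I_n -> 'I_m -> {ffun 'I_K -> nat} ->
               {ffun 'I_K -> R} -> {set 'I_K} -> 'I_K).

Notation st := (lstate R K (n + m)).
Notation cand := (cand mu alpha A blockend adj tb hatS).
Notation bu_upd := (bu_upd mu alpha A blockend tb hatS).
Notation Bj := (Bj mu alpha A tb hatS).
Notation phase_out := (phase_out mu alpha A tb hatS).
Notation recom := (recom mu alpha A tb hatS mal).
Notation next_ls := (next_ls mu alpha A blockend tb hatS mal).
Notation act_of := (act_of hatS).
Notation draw_prob := (draw_prob mu alpha A blockend adj tb hatS).
Notation phase_cost := (phase_cost mu gap alpha A tb hatS).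
Notation exp_cost := (exp_cost mu gap alpha A blockend adj tb hatS mal).
Implicit Types (gs : 'I_n -> st) (i : 'I_n) (h : 'I_(n + m)) (j : nat).

Lemma cnt_next j gs i h : l_cnt (next_ls j gs i h) = (phase_out j i (gs i)).1.2.
Proof. by rewrite /Defs.next_ls; case: ifP. Qed.

Lemma sm_next j gs i h : l_sm (next_ls j gs i h) = (phase_out j i (gs i)).2.
Proof. by rewrite /Defs.next_ls; case: ifP. Qed.

Lemma bu_next j gs i h : l_bu (next_ls j gs i h) = bu_upd j i (gs i).
Proof. by rewrite /Defs.next_ls; case: ifP. Qed.

Lemma pH_next j gs i h : l_pH (next_ls j gs i h) = Some h.
Proof. by rewrite /Defs.next_ls; case: ifP. Qed.

Lemma pR_next j gs i h : l_pR (next_ls j gs i h) = Some (recom j gs i h).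
Proof. by rewrite /Defs.next_ls; case: ifP. Qed.

Lemma recom_lshift j gs i i' : recom j gs i (lshift m i') = Bj j i' (gs i').
Proof. by rewrite /Defs.recom (unsplitK (inl _)). Qed.

Lemma recom_rshift j gs i q : recom j gs i (rshift n q) =
  mal j i q (phase_out j i (gs i)).1.2 (phase_out j i (gs i)).2 (act_of i (gs i)).
Proof. by rewrite /Defs.recom (unsplitK (inr _)). Qed.

Lemma act_next_same j gs i h : recom j gs i h \in act_of i (gs i) ->
  act_of i (next_ls j gs i h) = act_of i (gs i).
Proof. by move=> rS; rewrite /Defs.next_ls rS. Qed.

Lemma recom_in_next j gs i h : recom j gs i h \in act_of i (next_ls j gs i h).
Proof.
case: (boolP (recom j gs i h \in act_of i (gs i))) => rS.
  by rewrite act_next_same.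
by rewrite /Defs.next_ls rS /Defs.act_of /= /active !inE eqxx !orbT.
Qed.

Hypothesis tbP : forall X : {set 'I_K}, X != set0 -> tb X \in X.

(** The new [U] is one of the two old non-sticky arms, so the recommendation is the only possible
    newcomer. *)
Lemma act_next_sub j gs i h k : k \in act_of i (next_ls j gs i h) ->
  k \in act_of i (gs i) \/ k = recom j gs i h.
Proof.
case: (boolP (recom j gs i h \in act_of i (gs i))) => rS.
  by rewrite act_next_same //; left.
rewrite /Defs.next_ls rS /Defs.act_of /= /active !inE => /orP[->|/orP[/eqP ->|/eqP ->]].
- by left.
- left; set f := (fun _ => _).
  have [|] := @tb_argmax_nat _ tb tbP [set l_U (gs i); l_L (gs i)] f.
    by apply/set0Pn; exists (l_U (gs i)); rewrite !inE eqxx.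
  by rewrite !inE => /orP[->|->] _; rewrite !orbT.
- by right.
Qed.

(** A replacement keeps the more played of the two non-sticky arms; strict dominance makes this [a]
    whatever the tie-breaking rule. *)
Lemma dominating_stays j gs i h (a : 'I_K) : a \notin hatS i -> a \in act_of i (gs i) ->
  (forall k, k \in act_of i (gs i) -> k != a ->
    ((phase_out j i (gs i)).1.2 k - l_cnt (gs i) k <
     (phase_out j i (gs i)).1.2 a - l_cnt (gs i) a)%N) ->
  a \in act_of i (next_ls j gs i h).
Proof.
move=> aH aS dom.
case: (boolP (recom j gs i h \in act_of i (gs i))) => rS.
  by rewrite act_next_same.
rewrite /Defs.next_ls rS {1}/Defs.act_of /= /active.
rewrite (tb_argmax_nat_eq tbP (a := a)) ?inE ?eqxx ?orbT //.
  by move: aS; rewrite !inE (negbTE aH).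
move=> k; rewrite !inE => kUL ka; apply: dom => //.
by rewrite /Defs.act_of /active !inE kUL orbT.
Qed.

Lemma Bj_dominating j i (ls : st) (a : 'I_K) : a \in act_of i ls ->
  (forall k, k \in act_of i ls -> k != a ->
    ((phase_out j i ls).1.2 k - l_cnt ls k <
     (phase_out j i ls).1.2 a - l_cnt ls a)%N) ->
  Bj j i ls = a.
Proof. exact: (tb_argmax_nat_eq tbP). Qed.

Lemma Bj_in j i (ls : st) : act_of i ls != set0 -> Bj j i ls \in act_of i ls.
Proof. by move=> S0; have [] := tb_argmax_nat tbP
  (fun k => (phase_out j i ls).1.2 k - l_cnt ls k)%N S0. Qed.

Lemma bu_upd_next j gs i h k : (0 < j)%N ->
  bu_upd j.+1 i (next_ls j gs i h) k =
  if (k == h) && (Bj j.+1 i (next_ls j gs i h) != recom j gs i h)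
  then maxn (bu_upd j i (gs i) k) (blockend j.+1) else bu_upd j i (gs i) k.
Proof.
move=> j0; rewrite {1}/Defs.bu_upd pH_next pR_next bu_next ltnS j0 /=.
by case: (Bj _ _ _ == _) => /=; rewrite ?andbF //= ffunE andbT.
Qed.

Lemma bu_upd_le j i (ls : st) b : (forall k, (l_bu ls k <= b)%N) ->
  (b <= blockend j)%N -> forall k, (bu_upd j i ls k <= blockend j)%N.
Proof.
move=> le bj k; have lek := leq_trans (le k) bj; rewrite /Defs.bu_upd.
case: (l_pH ls) => // h; case: (l_pR ls) => // r; case: ifP => // _.
by rewrite ffunE; case: eqP => // _; rewrite geq_max lek leqnn.
Qed.

Lemma cand_sub j i (ls : st) : cand j i ls \subset nbrs adj i.
Proof.
by rewrite /Defs.cand; case: ifP => // _; apply/subsetP => x; rewrite inE => /andP[].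
Qed.

Lemma cand_neq0 j i (ls : st) : nbrs adj i != set0 -> cand j i ls != set0.
Proof. by rewrite /Defs.cand; case: ifP. Qed.

Lemma unblocked_in_cand j i (ls : st) h : h \in nbrs adj i ->
  (bu_upd j i ls h < j)%N -> h \in cand j i ls.
Proof.
move=> hN lt; have hC : h \in nbrs adj i :\: [set k | (j <= bu_upd j i ls k)%N].
  by rewrite !inE -ltnNge lt /=; move: hN; rewrite inE.
by rewrite /Defs.cand; case: ifPn.
Qed.

(** An unblocked neighbor [h'] is required because [cand] falls back to all neighbors when every one
    of them is blocked. *)
Lemma blocked_notin_cand j i (ls : st) h h' : h' \in nbrs adj i ->
  (bu_upd j i ls h' < j)%N -> (j <= bu_upd j i ls h)%N -> h \notin cand j i ls.
Proof.
move=> h'N lt le; have h'C : h' \in nbrs adj i :\: [set k | (j <= bu_upd j i ls k)%N].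
  by rewrite !inE -ltnNge lt /=; move: h'N; rewrite inE.
have C0 : nbrs adj i :\: [set k | (j <= bu_upd j i ls k)%N] != set0.
  by apply/set0Pn; exists h'.
by rewrite /Defs.cand C0 !inE le.
Qed.

Lemma draw_prob_ge0 j gs (h : {ffun 'I_n -> 'I_(n + m)}) : 0 <= draw_prob j gs h.
Proof. by apply: prodr_ge0 => i _; case: ifP => // _; rewrite invr_ge0. Qed.

Lemma draw_prob_eq0 j gs (h : {ffun 'I_n -> 'I_(n + m)}) i :
  h i \notin cand j i (gs i) -> draw_prob j gs h = 0.
Proof. by move=> hi; rewrite /Defs.draw_prob (bigD1 i) //= (negbTE hi) mul0r. Qed.

Hypothesis nbrs0 : forall i, nbrs adj i != set0.

Lemma sum_inv_cand j i (ls : st) :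
  \sum_(x : 'I_(n + m)) (if x \in cand j i ls then (#|cand j i ls|%:R)^-1 else 0) = 1 :> R.
Proof.
rewrite -big_mkcond /= sumr_const -[_ *+ _]mulr_natl mulfV // pnatr_eq0.
by rewrite cards_eq0 cand_neq0.
Qed.

Lemma sum_draw_prob j gs :
  \sum_(h : {ffun 'I_n -> 'I_(n + m)}) draw_prob j gs h = 1.
Proof.
rewrite /Defs.draw_prob -(bigA_distr_bigA (fun i x =>
  if x \in cand j i (gs i) then (#|cand j i (gs i)|%:R)^-1 else 0)).
by apply: big1 => i _; exact: sum_inv_cand.
Qed.

(** Draws are independent, so the probability factors: an agent outside [D] contributes 1, an agent
    in [D] the inverse of its number of candidates. *)
Lemma forced_draw_prob j gs (D : {set 'I_n}) (v : 'I_n -> 'I_(n + m)) (d : nat) :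
  (forall i, #|nbrs adj i| <= d)%N ->
  (forall i, i \in D -> v i \in cand j i (gs i)) ->
  ((d ^ #|D|)%:R)^-1 <=
  \sum_(h : {ffun 'I_n -> 'I_(n + m)} | [forall i in D, h i == v i]) draw_prob j gs h.
Proof.
move=> Nd vC; rewrite big_mkcond /=.
pose g i x : R := if x \in cand j i (gs i) then (#|cand j i (gs i)|%:R)^-1 else 0.
(* Moving the constraint into each factor makes the restricted sum distribute over the agents. *)
pose w i x : R := (if (i \in D) ==> (x == v i) then g i x else 0).
rewrite (_ : \sum_h _ = \sum_(h : {ffun 'I_n -> 'I_(n + m)}) \prod_i w i (h i)); last first.
  apply: eq_bigr => h _; case: ifPn => [/forall_inP hv|].
    by apply: eq_bigr => i _; rewrite /w; case: (boolP (i \in D)) => //= /hv ->.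
  case/forall_inPn => i iD hi; symmetry; rewrite (bigD1 i) //= /w iD /= (negbTE hi).
  by rewrite mul0r.
rewrite -(bigA_distr_bigA w) natrX -exprVn -prodr_const.
rewrite [X in X <= _]big_mkcond /=; apply: ler_prod => i _.
have inv0 : 0 <= (d%:R : R)^-1 by rewrite invr_ge0.
case: (boolP (i \in D)) => iD; last first.
  rewrite ler01 /=; rewrite (_ : \sum_x _ = 1) //.
  by rewrite -[RHS](sum_inv_cand j i (gs i)); apply: eq_bigr => x _; rewrite /w (negbTE iD).
rewrite inv0 /= (bigD1 (v i)) //= big1 ?addr0; last first.
  by move=> x xv; rewrite /w iD /= (negbTE xv).
rewrite /w eqxx implybT /g (vC _ iD) lef_pV2 ?posrE ?ltr0n.
- by rewrite ler_nat (leq_trans _ (Nd i)) // subset_leq_card // cand_sub.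
- by rewrite (leq_trans _ (Nd i)) // card_gt0.
- by rewrite card_gt0 cand_neq0.
Qed.

Hypothesis gap_ge0 : forall k, 0 <= gap k.

Lemma phase_cost_ge0 T j a (ls : st) : 0 <= phase_cost T j a ls.
Proof. exact: sumr_ge0. Qed.

Lemma exp_cost_ge0 T a fuel j gs : 0 <= exp_cost T a fuel j gs.
Proof.
elim: fuel j gs => [|fuel IH] j gs /=; apply: addr_ge0; rewrite ?phase_cost_ge0 //.
by apply: sumr_ge0 => h _; rewrite mulr_ge0 ?draw_prob_ge0.
Qed.

Definition next_state j gs (h : {ffun 'I_n -> 'I_(n + m)}) : 'I_n -> st :=
  fun i => next_ls j gs i (h i).

(** Induction on the fuel, keeping only the draws that follow [v]; the discarded trajectories have
    nonnegative cost. Every phase cost is discounted by the bound for the whole forced sequence,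
    which is weaker but uniform. *)
Lemma exp_cost_forced (Good : nat -> ('I_n -> st) -> Prop) (d : nat)
    (f : nat -> nat) (cost : nat -> R) T a J :
  (0 < d)%N -> (forall i, #|nbrs adj i| <= d)%N -> (forall j, 0 <= cost j) ->
  (forall j gs, (j <= J)%N -> Good j gs -> cost j <= phase_cost T j a (gs a)) ->
  (forall j gs, (j < J)%N -> Good j gs ->
    exists (D : {set 'I_n}) (v : 'I_n -> 'I_(n + m)),
    [/\ (#|D| <= f j)%N, (forall i, i \in D -> v i \in cand j i (gs i)) &
        forall h : {ffun 'I_n -> 'I_(n + m)},
          (forall i, h i \in cand j i (gs i)) -> (forall i, i \in D -> h i = v i) ->
          Good j.+1 (next_state j gs h)]) ->
  forall fuel j gs, Good j gs -> (j <= J <= j + fuel)%N ->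
  ((d ^ (\sum_(j <= i < J) f i))%:R)^-1 * \sum_(j <= i < J.+1) cost i
    <= exp_cost T a fuel j gs.
Proof.
move=> d0 Nd cost0 costP step.
have base fuel j gs : Good j gs -> j = J ->
    ((d ^ (\sum_(j <= i < J) f i))%:R)^-1 * \sum_(j <= i < J.+1) cost i
    <= exp_cost T a fuel j gs.
  move=> gd jJ; rewrite jJ in gd *; rewrite big_geq // expn0 invr1 mul1r big_nat1.
  apply: (@le_trans _ _ (phase_cost T J a (gs a))).
    exact: costP.
  case: fuel => [|fuel] /=; rewrite lerDl //.
  by apply: sumr_ge0 => h _; rewrite mulr_ge0 ?draw_prob_ge0 ?exp_cost_ge0.
elim=> [|fuel IH] j gs gd /andP[jJ Jf].
  by apply: base => //; apply/eqP; rewrite eqn_leq jJ; rewrite addn0 in Jf.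
move: jJ; rewrite leq_eqVlt => /orP[/eqP jJ|jJ]; first exact: base.
have [D [v [Df vC gdN]]] := step _ _ jJ gd.
rewrite /= (big_ltn jJ) (@big_ltn _ _ _ j J.+1) ?leqW //.
set r := (\sum_(j.+1 <= i < J) f i)%N; set C := \sum_(j.+1 <= i < J.+1) cost i.
have C0 : 0 <= C by apply: sumr_ge0.
have dr0 : 0 < ((d ^ r)%:R : R)^-1 by rewrite invr_gt0 ltr0n expn_gt0 d0.
have dr1 e : ((d ^ e)%:R : R)^-1 <= 1 by rewrite invf_le1 ?ler1n ?ltr0n ?expn_gt0 d0.
rewrite mulrDr; apply: lerD.
  apply: le_trans (costP _ _ (ltnW jJ) gd).
  by rewrite ler_piMl.
have le_f : ((d ^ f j)%:R : R)^-1 <= ((d ^ #|D|)%:R)^-1.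
  by rewrite lef_pV2 ?posrE ?ltr0n ?expn_gt0 ?d0 // ler_nat leq_pexp2l.
rewrite expnD natrM invfM -mulrA.
apply: (@le_trans _ _ (((d ^ #|D|)%:R)^-1 * (((d ^ r)%:R)^-1 * C))).
  by apply: ler_wpM2r => //; rewrite mulr_ge0 // ltW.
apply: (@le_trans _ _ ((\sum_(h : {ffun 'I_n -> 'I_(n + m)} | [forall i in D, h i == v i])
    draw_prob j gs h) * (((d ^ r)%:R)^-1 * C))).
  by apply: ler_wpM2r; [rewrite mulr_ge0 // ltW | exact: forced_draw_prob].
rewrite mulr_suml [X in _ <= X](bigID (fun h : {ffun 'I_n -> 'I_(n + m)} =>
  [forall i in D, h i == v i])) /=.
apply: ler_wpDr.
  by apply: sumr_ge0 => h _; rewrite mulr_ge0 ?draw_prob_ge0 ?exp_cost_ge0.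
apply: ler_sum => h /forall_inP hv.
(* Draws outside the candidate sets have probability 0, so [Good] need only survive admissible
   ones. *)
case: (boolP [forall i, h i \in cand j i (gs i)]) => [/forallP hC|/forallPn[i hi]]; last first.
  by rewrite (draw_prob_eq0 hi) !mul0r.
apply: ler_wpM2l; first exact: draw_prob_ge0.
apply: IH; last by rewrite jJ addSnnS.
by apply: gdN => // i /hv /eqP.
Qed.

(** Phase costs dominate the increments of [pot] along every trajectory, so they telescope, and
    averaging over the draws loses nothing. *)
Lemma exp_cost_potential (Base : nat -> ('I_n -> st) -> Prop) (pot : ('I_n -> st) -> R)
    (C : R) T a J :
  (forall j gs (h : {ffun 'I_n -> 'I_(n + m)}), (j < J)%N -> Base j gs ->
     Base j.+1 (next_state j gs h) /\
     pot (next_state j gs h) <= pot gs + phase_cost T j a (gs a)) ->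
  (forall gs, Base J gs -> C <= pot gs + phase_cost T J a (gs a)) ->
  forall fuel j gs, Base j gs -> (j <= J <= j + fuel)%N ->
  C - pot gs <= exp_cost T a fuel j gs.
Proof.
move=> step fin.
have base fuel j gs : Base j gs -> j = J -> C - pot gs <= exp_cost T a fuel j gs.
  move=> bs jJ; rewrite lerBlDr addrC; rewrite jJ in bs *.
  apply: (le_trans (fin _ bs)); rewrite lerD2l.
  case: fuel => [|fuel] /=; rewrite lerDl //.
  by apply: sumr_ge0 => h _; rewrite mulr_ge0 ?draw_prob_ge0 ?exp_cost_ge0.
elim=> [|fuel IH] j gs bs /andP[jJ Jf].
  by apply: base => //; apply/eqP; rewrite eqn_leq jJ; rewrite addn0 in Jf.
move: jJ; rewrite leq_eqVlt => /orP[/eqP jJ|jJ]; first exact: base.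
rewrite /= -lerBlDl.
rewrite -[X in X <= _]mul1r -[X in X * _](sum_draw_prob j gs) mulr_suml.
apply: ler_sum => h _; apply: ler_wpM2l; first exact: draw_prob_ge0.
have [bs' le] := step _ _ h jJ bs.
apply: (@le_trans _ _ (C - pot (next_state j gs h))).
  by move: le; rewrite -subr_ge0 => le; rewrite -subr_ge0; apply: (le_trans le); lra.
by apply: IH => //; rewrite jJ addSnnS.
Qed.

Lemma phase_cost_ge_const T j a (ls : st) (g : R) : act_of a ls != set0 ->
  (forall k, k \in act_of a ls -> g <= gap k) ->
  g * (count (fun t => t <= T)%N (phase_times A j))%:R <= phase_cost T j a ls.
Proof.
move=> S0 gk; rewrite /Defs.phase_cost /Defs.phase_out.
have sub := @run_phase_in _ _ mu alpha tb tbP (phase_times A j) (act_of a ls)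
  (l_cnt ls) (l_sm ls) S0.
have sz := size_run_phase mu alpha tb (phase_times A j) (act_of a ls) (l_cnt ls) (l_sm ls).
elim: (phase_times A j) (run_phase _ _ _ _ _ _ _).1.1 sz sub => [|t ts IH] [|k ks] //= sz sub.
  by rewrite mulr0 big_nil.
rewrite big_cons /= natrD mulrDr; have {}sz : size ks = size ts by case: sz.
have {}IH := IH ks sz (fun x xk => sub x (mem_behead (s := k :: ks) xk)).
case: leqP => _; last by rewrite mulr0 add0r.
by rewrite mulr1 lerD // gk // sub // mem_head.
Qed.

(** Each pull of [k] costs 1 and other pulls cost at least 0; this makes the count of [k] usable as
    a potential. *)
Lemma phase_cost_ge_count T j a (ls : st) (k : 'I_K) : gap k = 1 ->
  (forall t, t \in phase_times A j -> (t <= T)%N) ->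
  ((phase_out j a ls).1.2 k)%:R <= (l_cnt ls k)%:R + phase_cost T j a ls.
Proof.
move=> gk tT; rewrite /Defs.phase_cost /Defs.phase_out run_phase_count natrD lerD2l.
have sz := size_run_phase mu alpha tb (phase_times A j) (act_of a ls) (l_cnt ls) (l_sm ls).
elim: (phase_times A j) (run_phase _ _ _ _ _ _ _).1.1 sz tT => [|t ts IH] [|x ks] //= sz tT.
  by rewrite big_nil.
rewrite big_cons /= natrD tT ?mem_head //.
apply: lerD; last by apply: IH; [case: sz | move=> t' t'ts; apply: tT; rewrite inE t'ts orbT].
by case: eqP => [->|_]; rewrite ?gk // gap_ge0.
Qed.

End MultiAgent.

(** * The instance *)

Lemma JseqS l : (0 < l)%N -> Jseq l.+1 = ((Jseq l + 2) ^ 2)%N.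
Proof. by case: l. Qed.

Lemma Jseq1 : Jseq 1 = 256%N. Proof. by []. Qed.

Lemma Jseq_ltS l : (Jseq l + 2 < Jseq l.+1)%N.
Proof.
case: l => [|l]; first by rewrite Jseq1.
rewrite (@JseqS l.+1) // -mulnn; nia.
Qed.

Lemma Jseq_lt l l' : (l < l')%N -> (Jseq l + 2 < Jseq l')%N.
Proof.
elim: l' => // l' IH; rewrite ltnS leq_eqVlt => /orP[/eqP ->|/IH lt].
  exact: Jseq_ltS.
by have := Jseq_ltS l'; lia.
Qed.

Lemma Jseq_le l l' : (l <= l')%N -> (Jseq l <= Jseq l')%N.
Proof. by rewrite leq_eqVlt => /orP[/eqP ->|/Jseq_lt]; lia. Qed.

Lemma Jseq_inj l l' : Jseq l = Jseq l' -> l = l'.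
Proof.
by move=> eqJ; case: (ltngtP l l') => // /Jseq_lt; rewrite eqJ; lia.
Qed.

(** Each step at least squares, which doubles the exponent; at [l = 1] both sides are [2 ^ 8]. *)
Lemma Jseq_ge l : (0 < l)%N -> (2 ^ (2 ^ (l + 2)) <= Jseq l)%N.
Proof.
case: l => // l _; elim: l => [|l IH].
  by rewrite Jseq1.
rewrite (@JseqS l.+1) // (_ : l.+2 + 2 = (l.+1 + 2).+1)%N ?addSn //.
rewrite expnS mulnC expnM leq_exp2r // (leq_trans IH) //.
exact: leq_addr.
Qed.

(** * Logarithm estimates, gap sizes and phase times *)

Section Numeric.
Context {R : realType}.

(** From [expR (1 / 8) >= 9 / 8] and [(9 / 8) ^+ 6 >= 2]. *)
Lemma ln2_le : ln 2 <= 3 / 4 :> R.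
Proof.
rewrite -ler_expR lnK ?posrE; last by lra.
rewrite (_ : 3 / 4 = 1 / 8 * 6%:R); last by field.
rewrite expRM_natr.
apply: (@le_trans _ _ ((1 + 1 / 8) ^+ 6)); first lra.
rewrite ler_pXn2r ?nnegrE ?expR_ge0 ?expR_ge1Dx //; lra.
Qed.

Lemma expR_2d3_le : expR (2 / 3) <= 2 :> R.
Proof.
have e0 : 0 < expR (- (1 / 15)) :> R by exact: expR_gt0.
have le : expR (1 / 15) <= 15 / 14 :> R.
  rewrite -[X in expR X]opprK expRN -[X in _ <= X]invrK lef_pV2 ?posrE //; last by lra.
  by have := @expR_ge1Dx R (- (1 / 15)); lra.
rewrite (_ : 2 / 3 = 1 / 15 * 10%:R); last by field.
rewrite expRM_natr; apply: (@le_trans _ _ ((15 / 14) ^+ 10)); last lra.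
by rewrite ler_pXn2r ?nnegrE ?expR_ge0 //; lra.
Qed.

Lemma ln2_ge : 2 / 3 <= ln 2 :> R.
Proof. by rewrite -ler_expR lnK ?posrE ?expR_2d3_le //; lra. Qed.

(** Tangent bound at 256, with [ln 256 = 8 * ln 2 <= 6]. *)
Lemma ln_le_affine (x : R) : 0 < x -> ln x <= 5 + x / 256.
Proof.
move=> x0; rewrite {1}(_ : x = (x / 256) * 2 ^+ 8); last by field.
have x256 : 0 < x / 256 by rewrite divr_gt0.
rewrite lnM ?posrE ?exprn_gt0 // lnXn; last by lra.
have := @le_ln1Dx R (x / 256 - 1); have := ln2_le.
rewrite (_ : 1 + (x / 256 - 1) = x / 256); last by ring.
rewrite -mulr_natr => l2 /(_ ltac:(lra)) le.
lra.
Qed.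


(** The case of rank 1, with gap [13 / 15]: three times the pull bound for [alpha = 4] and
    [ln t <= 2 * ln j] stays below the length of phase [j]. *)
Lemma exploration_bound_first (j : nat) : (256 < j)%N ->
  3 * (1 + 4 * (2 * ln (j%:R : R)) / (13 / 15) ^+ 2) < 2 * j%:R - 1.
Proof.
move=> j256; have jR : 257 <= j%:R :> R by rewrite ler_nat.
have := @ln_le_affine j%:R ltac:(lra); lra.
Qed.

(* [D] is the inverse of the gap below the best mean: with [J_l >= D^4],
   the exploration of worse arms takes about [D^2 ln j <= sqrt j * ln j] pulls
   of a phase of length [2 j - 1]. *)
Lemma exploration_bound (D j : nat) : (16 <= D)%N -> (D ^ 4 <= j)%N ->
  3 * (1 + 4 * (2 * ln (j%:R : R)) / ((D%:R)^-1) ^+ 2) < 2 * j%:R - 1.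
Proof.
move=> D16 Dj; set x := Num.sqrt (j%:R : R).
have j0 : 0 <= j%:R :> R by [].
have jx : j%:R = x ^+ 2 by rewrite sqr_sqrtr.
have D2x : D%:R ^+ 2 <= x.
  rewrite /x -[X in X <= _](@ger0_norm R) ?exprn_ge0 // -sqrtr_sqr.
  by apply: ler_wsqrtr; rewrite -exprM -natrX ler_nat.
have DR : 16 <= D%:R :> R by rewrite ler_nat.
have D2 : 256 <= (D%:R : R) ^+ 2 by nra.
have x256 : 256 <= x by exact: le_trans D2x.
have lnx := @ln_le_affine x ltac:(lra).
rewrite jx lnXn; last by lra.
rewrite exprVn invrK mulr2n.
have lnx0 : 0 <= ln x by apply: ln_ge0; lra.
have le : ln x * D%:R ^+ 2 <= (5 + x / 256) * x.
  by apply: ler_pM => //; lra.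
have x2 : 256 * x <= x ^+ 2 by nra.
lra.
Qed.

(* Lower bound on the gap between the arm of rank [l] and arms of smaller rank. *)
Definition rank_gap (l : nat) : R :=
  if (l <= 1)%N then 13 / 15 else ((2 ^ (2 ^ l))%:R)^-1.

(** Termwise comparison with the geometric series of ratio [1 / 16]. This keeps every mean but that
    of arm 0 at most [14 / 15]. *)
Lemma sum_inv_double_exp l :
  \sum_(1 <= h < l) ((2 ^ (2 ^ h.+1))%:R)^-1 <= (1 / 15 : R).
Proof.
have H m : \sum_(1 <= h < m.+1) ((2 ^ (2 ^ h.+1))%:R)^-1
    <= (1 / 15) * (1 - ((16 ^ m)%:R)^-1) :> R.
  elim: m => [|m IH]; first by rewrite big_geq //= expn0 invr1 subrr mulr0.
  rewrite big_nat_recr //=.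
  have lt : (16 ^ m.+1 <= 2 ^ (2 ^ m.+2))%N.
    rewrite -[16%N]/(2 ^ 4)%N -expnM leq_pexp2l // 2!expnS mulnA leq_mul2l /=.
    by rewrite ltn_expl.
  have le : (((2 ^ (2 ^ m.+2))%:R : R)^-1) <= ((16 ^ m.+1)%:R)^-1.
    by rewrite lef_pV2 ?posrE ?ltr0n ?expn_gt0 // ler_nat.
  apply: (le_trans (lerD IH le)).
  by rewrite expnS natrM invfM; set y := ((16 ^ m)%:R)^-1; lra.
case: l => [|l]; first by rewrite big_geq //; lra.
apply: (le_trans (H l)); have : 0 <= ((16 ^ l)%:R : R)^-1 by rewrite invr_ge0.
lra.
Qed.

Lemma sum_inv_double_exp_ge0 l l' :
  0 <= \sum_(l <= h < l') ((2 ^ (2 ^ h.+1))%:R)^-1 :> R.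
Proof. by apply: sumr_ge0 => h _; rewrite invr_ge0. Qed.

Lemma rank_gap_gt0 l : 0 < rank_gap l.
Proof.
rewrite /rank_gap; case: leqP => _; first by lra.
by rewrite invr_gt0 ltr0n expn_gt0.
Qed.

(** For [l >= 2] the inverse gap is [D = 2 ^ (2 ^ l)], and [D ^ 4 = 2 ^ (2 ^ (l + 2)) <= Jseq l]. *)
Lemma exploration_bound_rank l j : (0 < l)%N -> (Jseq l < j)%N ->
  3 * (1 + inst_alpha * (2 * ln (j%:R : R)) / rank_gap l ^+ 2) < (2 * j - 1)%:R.
Proof.
move=> l0 Jj; rewrite natrB ?natrM; last by lia.
rewrite /rank_gap; case: leqP => l1.
  have {}l1 : l = 1%N by lia.
  by apply: exploration_bound_first; move: Jj; rewrite l1 Jseq1.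
apply: exploration_bound.
  rewrite -[16%N]/(2 ^ (2 ^ 2))%N leq_pexp2l // leq_pexp2l //.
rewrite -expnM -[4%N]/(2 ^ 2)%N -expnD; apply: leq_trans (ltnW Jj).
exact: Jseq_ge.
Qed.

Lemma mem_phase_times j t : (0 < j)%N -> t \in phase_times inst_A j ->
  (j.-1 ^ 2 < t <= j ^ 2)%N.
Proof.
move=> j0; rewrite /phase_times mem_iota /inst_A => /andP[-> /=].
have : (j.-1 ^ 2 <= j ^ 2)%N by rewrite leq_exp2r // leq_pred.
lia.
Qed.

Lemma phase_times_ge j t : (3 <= j)%N -> t \in phase_times inst_A j -> (j <= t)%N.
Proof.
move=> j3 /mem_phase_times -/(_ ltac:(lia))/andP[lt _].
by apply: leq_trans lt; rewrite -mulnn; nia.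
Qed.

Lemma size_phase_times j : (0 < j)%N -> size (phase_times inst_A j) = (2 * j - 1)%N.
Proof. by case: j => // j _; rewrite size_iota /inst_A /= -!mulnn; lia. Qed.

Lemma ln_phase_times j t : (0 < j)%N -> t \in phase_times inst_A j ->
  ln (t%:R : R) <= 2 * ln (j%:R : R).
Proof.
move=> j0 /(mem_phase_times j0)/andP[lt le].
have <- : ln ((j%:R : R) ^+ 2) = 2 * ln j%:R.
  by rewrite lnXn ?ltr0n // mulr_natl.
rewrite ler_ln ?posrE ?exprn_gt0 ?ltr0n //; last by lia.
by rewrite -natrX ler_nat.
Qed.

End Numeric.

(** * Means of the arms and play within one phase *)

Section Instance.
Context {R : realType} (n : nat).
Hypothesis n4 : (4 <= n)%N.

Notation mu := (@inst_mu R n).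
Notation gap := (@inst_gap R n).

Lemma inst_mu_bad (k : 'I_n) : (n./2 <= k)%N -> mu k = 0.
Proof.
move=> hk; rewrite /inst_mu; case: eqP => [/=|_]; first by lia.
by rewrite ltnNge hk.
Qed.

Lemma inst_mu_rank (k : 'I_n) l : (0 < l < n./2)%N -> k = (n./2 - l)%N :> nat ->
  mu k = 13 / 15 + \sum_(1 <= h < l) ((2 ^ (2 ^ h.+1))%:R)^-1.
Proof.
move=> l0 vk; rewrite /inst_mu /=; have -> : (k.+1 == 1%N) = false.
  by apply/eqP; rewrite vk; lia.
have -> : (k < n./2)%N by rewrite vk; lia.
by rewrite (_ : (n./2 - k.+1).+1 = l) // vk; lia.
Qed.

Lemma inst_mu_bounds (k : 'I_n) : 0 <= mu k <= 1.
Proof.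
rewrite /inst_mu; case: eqP => _; first by lra.
case: ifP => _; last by lra.
have := @sum_inv_double_exp R (n./2 - (val k).+1).+1.
have := @sum_inv_double_exp_ge0 R 1 (n./2 - (val k).+1).+1.
lra.
Qed.

Lemma inst_gap_ge0 (k : 'I_n) : 0 <= gap k.
Proof. by rewrite /inst_gap; have := inst_mu_bounds k; lra. Qed.

Lemma inst_gap_bad (k : 'I_n) : (n./2 <= k)%N -> gap k = 1.
Proof. by move=> hk; rewrite /inst_gap inst_mu_bad // subr0. Qed.

Lemma inst_gap_ge (k : 'I_n) : (0 < k)%N -> 1 / 15 <= gap k.
Proof.
move=> k0; rewrite /inst_gap /inst_mu eqSS (negbTE (lt0n_neq0 k0)).
case: ifP => _; last by lra.
by have := @sum_inv_double_exp R (n./2 - (val k).+1).+1; lra.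
Qed.

(** An arm of positive mean after [a] lacks the last term of the sum for [a], which is [rank_gap l];
    an arm of mean 0 lies at least [13 / 15] below. *)
Lemma inst_mu_gap (a k : 'I_n) l : (0 < l < n./2)%N -> a = (n./2 - l)%N :> nat ->
  (a < k)%N -> mu k + rank_gap l <= mu a.
Proof.
move=> l0 va ak; rewrite (inst_mu_rank l0 va).
have pos := @sum_inv_double_exp_ge0 R 1 l.
rewrite /rank_gap; have [hk|kh] := leqP n./2 k.
  rewrite (inst_mu_bad hk); case: leqP => [_|l1]; first by lra.
  have : ((2 ^ (2 ^ l))%:R : R)^-1 <= 2^-1.
    rewrite lef_pV2 ?posrE ?ltr0n ?expn_gt0 // ler_nat.
    by rewrite -{1}[2%N]expn1 leq_pexp2l // expn_gt0.
  lra.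
have [l' vk] : exists l', l = (n./2 - k + l'.+1)%N.
  by exists (l - (n./2 - k)).-1; lia.
have l1 : (l <= 1)%N = false by lia.
rewrite l1 (@inst_mu_rank k (n./2 - k)%N); [|lia|lia].
rewrite (@big_cat_nat _ _ _ (n./2 - k)%N 1 l) /=; [|lia|lia].
rewrite -addrA lerD2l lerD2l.
have -> : l = l.-1.+1 by lia.
rewrite big_nat_recr /=; last by lia.
by rewrite lerDr sum_inv_double_exp_ge0.
Qed.

Context (tb : {set 'I_n} -> 'I_n).
Hypothesis tbP : forall X : {set 'I_n}, X != set0 -> tb X \in X.

Notation run := (run_phase mu inst_alpha tb).
Implicit Types (S : {set 'I_n}) (c : {ffun 'I_n -> nat}) (s : {ffun 'I_n -> R}).

Lemma top_rank_dominates l j S c s (a : 'I_n) :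
  (forall k, s k = mu k * (c k)%:R) -> (#|S| <= 3)%N ->
  (0 < l < n./2)%N -> (Jseq l < j)%N -> a = (n./2 - l)%N :> nat -> a \in S ->
  (forall k, k \in S -> n./2 <= k + l)%N ->
  forall k, k \in S -> k != a ->
    ((run (phase_times inst_A j) S c s).1.2 k - c k <
     (run (phase_times inst_A j) S c s).1.2 a - c a)%N.
Proof.
move=> mean S3 l0 Jj va aS Sl.
have j0 : (0 < j)%N by lia.
pose Y : R := 1 + inst_alpha * (2 * ln j%:R) / rank_gap l ^+ 2.
apply: (@dominating_arm _ _ mu inst_alpha tb tbP _ S c s a Y) => //.
  move=> k kS ka; apply: (@suboptimal_pulls _ _ mu _ tb tbP _ S c s a) => //.
  - exact: rank_gap_gt0.
  - apply: inst_mu_gap => //; have := Sl _ kS; move: ka; rewrite -val_eqE /= va.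
    by move=> /eqP; lia.
  - by rewrite mulr_ge0 // ln_ge0 // ler1n.
  - by move=> t; exact: ln_phase_times.
by rewrite size_phase_times // exploration_bound_rank //; lia.
Qed.

(** An arm pulled fewer than [ln j] times keeps a bonus above 2, whereas an arm taking a third of
    the phase has bonus at most 1, hence index at most 2, when last pulled: a contradiction. *)
Lemma sticky_pulls j S c s (x : 'I_n) :
  (forall k, s k = mu k * (c k)%:R) -> (#|S| <= 3)%N ->
  (256 <= j)%N -> x \in S ->
  ln (j%:R : R) <= ((run (phase_times inst_A j) S c s).1.2 x)%:R.
Proof.
move=> mean S3 j256 xS; have j0 : (0 < j)%N by lia.
have S0 : S != set0 by apply/set0Pn; exists x.
set o := (run _ S c s).1.2; rewrite leNgt; apply/negP => ltx.
have jR : 256 <= j%:R :> R by rewrite ler_nat.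
have lnj := @ln_le_affine R j%:R ltac:(lra).
(* At most three arms share the [2 * j - 1] pulls of the phase. *)
have [k kS kbig] : exists2 k, k \in S & (2 * j - 1 <= 3 * (o k - c k))%N.
  case: (boolP [exists k in S, (2 * j - 1 <= 3 * (o k - c k))%N]).
    by case/existsP => k /andP[]; exists k.
  rewrite negb_exists => /forallP small.
  have : (\sum_(k in S) 3 * (o k - c k) <= \sum_(k in S) (2 * j - 2))%N.
    apply: leq_sum => k kS; have := small k; rewrite kS /= -ltnNge; lia.
  rewrite -big_distrr /= run_phase_sum // size_phase_times // sum_nat_const.
  have : (#|S| * (2 * j - 2) <= 3 * (2 * j - 2))%N by rewrite leq_mul2r S3 orbT.
  by move=> le1 le2; have := leq_trans le2 le1; lia.
have kx : k != x.
  apply/eqP => kx; move: kbig; rewrite kx => kbig.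
  have : (2 * j - 1 <= 3 * o x)%N by lia.
  rewrite -(ler_nat R) natrB ?natrM; last by lia.
  by move: ltx; rewrite /o; lra.
have ltk : (c k < o k)%N by lia.
have [o1|[t [c' [tts bnd ck ck0 idx]]]] := last_pull_index tbP mean S0 ltk.
  by move: kbig; rewrite o1; lia.
have [cx0] := idx _ xS; rewrite /ucb_index /inst_alpha.
have c'k : (j <= 2 * c' k)%N by move: ck kbig; rewrite -/o; lia.
have /andP[mux _] := inst_mu_bounds x; have /andP[_ muk] := inst_mu_bounds k.
have c'kR : j%:R <= 2 * (c' k)%:R :> R by rewrite -natrM ler_nat.
have lnt := @ln_phase_times R _ _ j0 tts.
have lntj : ln (j%:R : R) <= ln (t%:R : R).
  have jt : (j <= t)%N by apply: phase_times_ge tts; exact: leq_trans j256.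
  by rewrite ler_ln ?posrE ?ltr0n ?ler_nat //; exact: leq_trans jt.
have sk : Num.sqrt (4 * ln (t%:R : R) / (c' k)%:R) <= 1.
  rewrite -[X in _ <= X]sqrtr1; apply: ler_wsqrtr.
  rewrite ler_pdivrMr ?ltr0n // mul1r; lra.
have lnj0 : 0 < ln (j%:R : R) by rewrite ln_gt0 //; lra.
have cxR : 0 < (c' x)%:R :> R by rewrite ltr0n.
have sx : 2 < Num.sqrt (4 * ln (t%:R : R) / (c' x)%:R).
  rewrite -[X in X < _]ger0_norm // -sqrtr_sqr; rewrite ltr_sqrt; last first.
    by apply: divr_gt0 => //; lra.
  rewrite ltr_pdivlMr //.
  have /andP[_] := bnd x; rewrite -(ler_nat R) -/o => cxo; lra.
by move: sk sx mux muk => /=; lra.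
Qed.

End Instance.

(** * Propagation of the blocking *)

Lemma card_ord_pair n x y :
  (#|[set i : 'I_n | (i == x :> nat) || (i == y :> nat)]| <= 2)%N.
Proof.
set D := [set _ | _]; rewrite cardE -(size_map val).
apply: (@uniq_leq_size _ _ [:: x; y]); first by rewrite map_inj_uniq ?enum_uniq //; exact: val_inj.
by move=> _ /mapP[i + ->]; rewrite mem_enum !inE.
Qed.

Section Attack.
Context {R : realType} (n : nat).
Hypothesis n4 : (4 <= n)%N.
Context (tb : {set 'I_n} -> 'I_n).
Hypothesis tbP : forall X : {set 'I_n}, X != set0 -> tb X \in X.
Context (hatS : 'I_n -> {set 'I_n}).
Hypothesis card_hatS : forall i, #|hatS i| = 1%N.
Hypothesis hatS_bad : forall i : 'I_n, (n./2 <= i)%N ->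
  forall k, k \in hatS i -> (n./2 <= k)%N.

Notation mu := (@inst_mu R n).
Notation st := (lstate R n (n + 1)).
Notation cand := (cand mu inst_alpha inst_A inst_blockend (@inst_adj n) tb hatS).
Notation bu_upd := (bu_upd mu inst_alpha inst_A inst_blockend tb hatS).
Notation Bj := (Bj mu inst_alpha inst_A tb hatS).
Notation phase_out := (phase_out mu inst_alpha inst_A tb hatS).
Notation recom := (recom mu inst_alpha inst_A tb hatS (inst_mal tb)).
Notation next_ls := (next_ls mu inst_alpha inst_A inst_blockend tb hatS (inst_mal tb)).
Notation next_gs := (next_state mu inst_alpha inst_A inst_blockend tb hatS (inst_mal tb)).
Notation act_of := (act_of hatS).
Notation nbrs := (nbrs (@inst_adj n)).
Notation malN := (rshift n (ord0 : 'I_1)).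
Implicit Types (gs : 'I_n -> st) (i : 'I_n) (j l : nat).

Lemma malicious_nbr i : malN \in nbrs i.
Proof. by rewrite inE /inst_adj /= addn0 eqxx ltn_ord !orbT. Qed.

Lemma nbrs_neq0 i : nbrs i != set0.
Proof. by apply/set0Pn; exists malN; exact: malicious_nbr. Qed.

Lemma honest_nbr i i' :
  (lshift 1 i' \in nbrs i) = (i.+1 == i' :> nat) || (i'.+1 == i :> nat).
Proof.
rewrite inE /inst_adj /= !ltn_ord /= (ltn_eqF (ltn_ord i)) (ltn_eqF (ltn_ord i')).
by rewrite !orbF.
Qed.

Lemma node_cases (x : 'I_(n + 1)) : x = malN \/ exists i', x = lshift 1 i'.
Proof.
by case: (split_ordP x) => [i' ->|q ->]; [right; exists i'|left; rewrite (ord1 q)].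
Qed.

Lemma lshift_neq_mal i' : (lshift 1 i' == malN) = false.
Proof. by rewrite -val_eqE /= addn0 ltn_eqF. Qed.

Lemma card_nbrs i : (#|nbrs i| <= 3)%N.
Proof.
rewrite cardE -(size_map val).
apply: (@uniq_leq_size _ _ [:: i.-1; i.+1; n]).
  by rewrite map_inj_uniq ?enum_uniq //; exact: val_inj.
move=> _ /mapP[x + ->]; rewrite mem_enum.
case: (node_cases x) => [-> _|[i' ->]]; first by rewrite !inE /= addn0 eqxx !orbT.
by rewrite honest_nbr !inE /=; case/orP => /eqP <-; rewrite eqxx ?orbT.
Qed.

Lemma card_act i (ls : st) : (#|act_of i ls| <= 3)%N.
Proof.
rewrite /Defs.act_of /active (leq_trans (leq_card_setU _ _)) // card_hatS.
by rewrite cards2; case: (_ != _).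
Qed.

Lemma hatS_act i (ls : st) : hatS i \subset act_of i ls.
Proof. exact: subsetUl. Qed.

Lemma act_neq0 i (ls : st) : act_of i ls != set0.
Proof.
rewrite -card_gt0 (leq_trans _ (subset_leq_card (hatS_act i ls))) //.
by rewrite card_hatS.
Qed.

Lemma Bj_act j i (ls : st) : Bj j i ls \in act_of i ls.
Proof. by apply: Bj_in => //; exact: act_neq0. Qed.

Lemma malicious_generic j i q c (s : {ffun 'I_n -> R}) S :
  (forall l, (0 < l < n./2)%N -> j = Jseq l ->
     i <> (n./2 + l)%N :> nat /\ i <> (n./2 + l).+1 :> nat) ->
  inst_mal tb j i q c s S = most_played tb S c
    (run_phase mu inst_alpha tb (phase_times inst_A j.+1) S c s).1.2.
Proof.
move=> gen; rewrite /inst_mal; case: pickP => [l /and4P[l0 lh /eqP jJ il]|] //.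
have [ne1 ne2] := gen l (introT andP (conj l0 lh)) jJ.
by move: il => /orP[] /eqP /=; lia.
Qed.

Lemma malicious_attack j i q c (s : {ffun 'I_n -> R}) S l :
  (0 < l < n./2)%N -> j = Jseq l ->
  i = (n./2 + l)%N :> nat \/ i = (n./2 + l).+1 :> nat ->
  inst_mal tb j i q c s S = (n./2 - l)%N :> nat.
Proof.
move=> l0 jJ il; rewrite /inst_mal; case: pickP => [l' /and4P[l'0 l'h /eqP jJ' _]|].
  have <- : val l' = l by apply: Jseq_inj; rewrite -jJ -jJ'.
  by rewrite insubdK // unfold_in /=; lia.
have ln : (l < n)%N by lia.
move/(_ (Ordinal ln)); rewrite /= jJ eqxx; case: il => ->; lia.
Qed.

(** Off the attacks the recommended arm is active, so the active set is unchanged and phase [j.+1]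
    runs exactly as the malicious agent simulated it. Hence it is not blocked. *)
Lemma malicious_rec_generic j gs i :
  (forall l, (0 < l < n./2)%N -> j = Jseq l ->
     i <> (n./2 + l)%N :> nat /\ i <> (n./2 + l).+1 :> nat) ->
  recom j gs i malN \in act_of i (gs i) /\
  Bj j.+1 i (next_ls j gs i malN) = recom j gs i malN.
Proof.
move=> gen; have rE := recom_rshift mu inst_alpha inst_A tb hatS (inst_mal tb) j gs i ord0.
rewrite malicious_generic // in rE.
have rS : recom j gs i malN \in act_of i (gs i).
  rewrite rE /most_played.
  by case: (tb_argmax_nat tbP (fun k => (run_phase mu inst_alpha tb
    (phase_times inst_A j.+1) (act_of i (gs i)) (phase_out j i (gs i)).1.2
    (phase_out j i (gs i)).2).1.2 k - (phase_out j i (gs i)).1.2 k)%N (act_neq0 i (gs i))).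
split=> //; rewrite rE /Defs.Bj /Defs.phase_out act_next_same //.
by rewrite cnt_next sm_next.
Qed.

(** Facts holding along every trajectory. The stored blocks were last updated in phase [j.-1], hence
    the bound [j.-1 ^ 2]. *)
Definition base_inv j gs : Prop := forall i,
  (forall k, l_sm (gs i) k = mu k * (l_cnt (gs i) k)%:R) /\
  (forall k, l_bu (gs i) k <= j.-1 ^ 2)%N.

Lemma base_step j gs ff : (0 < j)%N -> base_inv j gs -> base_inv j.+1 (next_gs j gs ff).
Proof.
move=> j0 base i; have [mean bu] := base i; split=> k.
  rewrite /next_state cnt_next sm_next; exact: run_phase_mean.
rewrite /next_state bu_next -[X in (_ <= X)%N]/(inst_blockend j); apply: (bu_upd_le _ _ _ _ _ _ bu).
by rewrite /inst_blockend leq_exp2r // leq_pred.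
Qed.

Lemma agent_dominates l j gs i (a : 'I_n) : base_inv j gs ->
  (0 < l < n./2)%N -> (Jseq l < j)%N -> a = (n./2 - l)%N :> nat ->
  a \in act_of i (gs i) -> (forall k, k \in act_of i (gs i) -> n./2 <= k + l)%N ->
  forall k, k \in act_of i (gs i) -> k != a ->
    ((phase_out j i (gs i)).1.2 k - l_cnt (gs i) k <
     (phase_out j i (gs i)).1.2 a - l_cnt (gs i) a)%N.
Proof.
move=> base l0 Jj va aS Sl; have [mean _] := base i.
exact: (top_rank_dominates n4 tbP mean (card_act i (gs i)) l0 Jj va aS Sl).
Qed.

Lemma agent_best l j gs i (a : 'I_n) : base_inv j gs ->
  (0 < l < n./2)%N -> (Jseq l < j)%N -> a = (n./2 - l)%N :> nat ->
  a \in act_of i (gs i) -> (forall k, k \in act_of i (gs i) -> n./2 <= k + l)%N ->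
  Bj j i (gs i) = a.
Proof.
move=> base l0 Jj va aS Sl; apply: (Bj_dominating tbP) => //.
exact: (agent_dominates base l0 Jj va aS Sl).
Qed.

(** Sticky arms of right-half agents have rank at most 0, so [a] sits in a non-sticky slot and
    survives as the most played arm. *)
Lemma best_stays l j gs i x (a : 'I_n) : base_inv j gs ->
  (0 < l < n./2)%N -> (Jseq l < j)%N -> a = (n./2 - l)%N :> nat -> (n./2 <= i)%N ->
  a \in act_of i (gs i) -> (forall k, k \in act_of i (gs i) -> n./2 <= k + l)%N ->
  a \in act_of i (next_ls j gs i x).
Proof.
move=> base l0 Jj va hi aS Sl; apply: dominating_stays => //.
  by apply/negP => /(hatS_bad hi); rewrite va; lia.
exact: (agent_dominates base l0 Jj va aS Sl).
Qed.

(* Holds at the start of the phases [j] in (J_l + 1, J_(l+1)], and from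
   phase 1 on if [l = 0]: agents from [h + l] on know arms of rank at most [l]
   only, agent [h + l] is shielded by its blocklist through phase J_(l+1), and the block that agent [h + l + 1] may have
   put on it expires in time for the next attack. *)
Definition level_inv l j gs : Prop :=
  [/\ forall i, (n./2 + l <= i)%N -> forall k, k \in act_of i (gs i) -> (n./2 <= k + l)%N,
      forall i, (n./2 + l <= i)%N -> bu_upd j i (gs i) malN = 0%N,
      (0 < l)%N -> forall i i', i = (n./2 + l)%N :> nat -> i'.+1 = i ->
        (Jseq l.+1 <= bu_upd j i (gs i) (lshift 1 i'))%N,
      (0 < l)%N -> forall i (a : 'I_n), (n./2 + l <= i <= n./2 + l.+1)%N ->
        a = (n./2 - l)%N :> nat -> a \in act_of i (gs i) &
      forall i i', i = (n./2 + l).+1 :> nat -> i' = (n./2 + l)%N :> nat ->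
        (bu_upd j i (gs i) (lshift 1 i') <= Jseq l.+1)%N].

(* Holds at phase J_(l+1) + 1, where the arm of rank [l + 1] is already known but
   agent [h + l + 1] has not yet contacted agent [h + l]. *)
Definition attacked_inv l j gs : Prop :=
  [/\ forall i, i = (n./2 + l)%N :> nat ->
        forall k, k \in act_of i (gs i) -> (n./2 <= k + l)%N,
      forall i, (n./2 + l < i)%N -> forall k, k \in act_of i (gs i) -> (n./2 <= k + l.+1)%N,
      forall i, (n./2 + l < i)%N -> bu_upd j i (gs i) malN = 0%N,
      forall i (a : 'I_n), (n./2 + l.+1 <= i <= n./2 + l.+2)%N ->
        a = (n./2 - l.+1)%N :> nat -> a \in act_of i (gs i) &
      forall i i', i = (n./2 + l).+1 :> nat -> i' = (n./2 + l)%N :> nat ->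
        (bu_upd j i (gs i) (lshift 1 i') <= Jseq l.+1)%N].

(** The only honest contact from outside this range is the left neighbor of agent h + l: excluded by
    the blocklist if [l > 0], by the last hypothesis if [l = 0]. *)
Lemma level_draw l j gs i x : level_inv l j gs -> (0 < j <= Jseq l.+1)%N ->
  (n./2 + l <= i)%N -> x \in cand j i (gs i) -> (l = 0%N -> i = n./2 :> nat -> x = malN) ->
  x = malN \/ exists2 i', x = lshift 1 i' & (n./2 + l <= i')%N.
Proof.
case=> _ unbl bl _ _ /andP[j0 jJ] li xC forced.
case: (node_cases x) => [->|[i' xE]]; [by left|right; exists i' => //].
have := subsetP (cand_sub mu inst_alpha inst_A inst_blockend (@inst_adj n) tb hatS j i (gs i)) _ xC.
rewrite xE honest_nbr leqNgt => adj; apply/negP => lt.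
have {adj} i'i : i'.+1 = i by case/orP: adj => /eqP; lia.
have iE : i = (n./2 + l)%N :> nat by lia.
case: (posnP l) => l0.
  have := forced l0 ltac:(lia); rewrite xE => /eqP.
  by rewrite lshift_neq_mal.
suff /negP : x \notin cand j i (gs i) by [].
apply: (blocked_notin_cand (malicious_nbr i)); rewrite ?unbl // xE.
by rewrite (leq_trans jJ) // bl.
Qed.

(** For [l > 0] the invariant persists by itself. At level 0 no blocklist shields agent h yet, and
    agent h + 1 must not block agent h, so both are made to draw the malicious agent. *)
Lemma level_window_step l j gs : (l < n./2)%N -> (Jseq l < j < Jseq l.+1)%N ->
  base_inv j gs -> level_inv l j gs ->
  exists (D : {set 'I_n}) (v : 'I_n -> 'I_(n + 1)),
  [/\ (#|D| <= 2 * (j <= 256))%N, (forall i, i \in D -> v i \in cand j i (gs i)) &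
      forall ff : {ffun 'I_n -> 'I_(n + 1)},
        (forall i, ff i \in cand j i (gs i)) -> (forall i, i \in D -> ff i = v i) ->
        level_inv l j.+1 (next_gs j gs ff)].
Proof.
move=> lh /andP[Jj jJ] base inv; have [act unbl bl best unbl'] := inv.
have j0 : (0 < j)%N by lia.
exists (if l is 0 then [set i : 'I_n | (i == n./2 :> nat) || (i == n./2.+1 :> nat)] else set0).
exists (fun=> malN); split.
- case: l Jj jJ {lh inv act unbl bl best unbl'} => [|l] _; last by rewrite cards0.
  by rewrite Jseq1 => jJ; rewrite (ltnW jJ); exact: card_ord_pair.
- case: l {lh Jj jJ inv act bl best unbl'} unbl => [|l] unbl i; last by rewrite inE.
  rewrite inE => hi; apply: unblocked_in_cand; first exact: malicious_nbr.
  by rewrite unbl //; case/orP: hi => /eqP ->; lia.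
move=> ff ffC ffD.
have base' := base_step ff j0 base.
have forced i : l = 0%N -> i = n./2 :> nat \/ i = n./2.+1 :> nat -> ff i = malN.
  by move=> l0 hi; apply: ffD; rewrite l0 inE; case: hi => ->; rewrite eqxx ?orbT.
have draw i : (n./2 + l <= i)%N ->
    ff i = malN \/ exists2 i', ff i = lshift 1 i' & (n./2 + l <= i')%N.
  move=> li; apply: (level_draw inv _ li (ffC i)); first by rewrite j0 ltnW.
  by move=> l0 hi; apply: forced => //; left.
have gen i : forall l', (0 < l' < n./2)%N -> j = Jseq l' ->
     i <> (n./2 + l')%N :> nat /\ i <> (n./2 + l').+1 :> nat.
  move=> l' _ jJ'; exfalso; case: (leqP l' l) => [/Jseq_le|/Jseq_le]; lia.
have rec i : (n./2 + l <= i)%N -> (n./2 <= recom j gs i (ff i) + l)%N.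
  move=> li; case: (draw i li) => [->|[i' -> li']].
    by apply: (act i) => //; case: (malicious_rec_generic gs (gen i)).
  by rewrite recom_lshift; apply: (act i') => //; exact: Bj_act.
have act' i : (n./2 + l <= i)%N ->
    forall k, k \in act_of i (next_gs j gs ff i) -> (n./2 <= k + l)%N.
  by move=> li k /(act_next_sub tbP)[/act|->]; [exact|exact: rec].
have best' : (0 < l)%N -> forall i (a : 'I_n), (n./2 + l <= i <= n./2 + l.+1)%N ->
    a = (n./2 - l)%N :> nat -> a \in act_of i (next_gs j gs ff i).
  move=> l0 i a li va; apply: (@best_stays l) => //; [by rewrite l0|lia|exact: best|].
  by apply: act; lia.
split=> //.
- move=> i li; rewrite bu_upd_next // unbl //; case: andP => // -[/eqP mE].
  by rewrite -mE; have [_ ->] := malicious_rec_generic gs (gen i); rewrite eqxx.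
- move=> l0 i i' iE i'i; rewrite bu_upd_next //; have := bl l0 i i' iE i'i.
  by case: ifP => // _ le; rewrite leq_max le.
(* Agent h + l + 1 cannot newly block agent h + l: at level 0 it drew the malicious agent, and
   otherwise both play the rank-[l] arm most. *)
- move=> i i' iE i'E; rewrite bu_upd_next //; have := unbl' i i' iE i'E.
  case: andP => // -[/eqP fE] /eqP BE; exfalso; apply: BE.
  case: (posnP l) => l0.
    by have /eqP := forced i l0 ltac:(lia); rewrite -fE lshift_neq_mal.
  have ln : (n./2 - l < n)%N by lia.
  rewrite -fE recom_lshift (@agent_best l j gs i' (Ordinal ln)) ?l0 //.
  + have := @agent_best l j.+1 _ i (Ordinal ln) base'; rewrite /next_state -fE; apply.
    * by rewrite l0.
    * by lia.
    * by [].
    * by have := best' l0 i (Ordinal ln); rewrite /next_state -fE; apply => //; lia.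
    * by have := act' i; rewrite /next_state -fE; apply; lia.
  + by apply: best => //; lia.
  + by apply: act; lia.
Qed.

(** Agents h + l + 1 and h + l + 2 are made to draw the malicious agent and receive the arm of rank
    [l.+1]; if [l = 0], agent h must still be kept from its left neighbor. *)
Lemma level_attack_step l gs : (l.+1 < n./2)%N -> let j := Jseq l.+1 in
  base_inv j gs -> level_inv l j gs ->
  exists (D : {set 'I_n}) (v : 'I_n -> 'I_(n + 1)),
  [/\ (#|D| <= 2 * (j <= 256) + 2)%N, (forall i, i \in D -> v i \in cand j i (gs i)) &
      forall ff : {ffun 'I_n -> 'I_(n + 1)},
        (forall i, ff i \in cand j i (gs i)) -> (forall i, i \in D -> ff i = v i) ->
        attacked_inv l j.+1 (next_gs j gs ff)].
Proof.
move=> lh j base inv; have [act unbl bl best unbl'] := inv.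
have j0 : (0 < j)%N by rewrite /j; have := Jseq_ltS l; lia.
exists ((if l is 0 then [set i : 'I_n | (i == n./2 :> nat) || (i == n./2 :> nat)] else set0)
  :|: [set i : 'I_n | (i == (n./2 + l).+1 :> nat) || (i == (n./2 + l).+2 :> nat)]).
exists (fun=> malN); split.
- apply: (leq_trans (leq_card_setU _ _)); apply: leq_add; last exact: card_ord_pair.
  rewrite /j; case: (l) => [|l']; last by rewrite cards0.
  by rewrite Jseq1; exact: card_ord_pair.
- move=> i; rewrite inE => iD; apply: unblocked_in_cand; first exact: malicious_nbr.
  by rewrite unbl //; move: iD; case: (l) => [|l']; rewrite !inE; lia.
move=> ff ffC ffD.
have base' := base_step ff j0 base.
have forced0 i : l = 0%N -> i = n./2 :> nat -> ff i = malN.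
  by move=> l0 hi; apply: ffD; rewrite l0 !inE hi eqxx.
have forced i : (n./2 + l.+1 <= i <= n./2 + l.+2)%N -> ff i = malN.
  by move=> hi; apply: ffD; rewrite inE orbC inE; apply/orP; left; lia.
have draw i : (n./2 + l <= i)%N ->
    ff i = malN \/ exists2 i', ff i = lshift 1 i' & (n./2 + l <= i')%N.
  move=> li; apply: (level_draw inv _ li (ffC i)); first by rewrite j0 leqnn.
  exact: forced0.
have gen i : ~~ (n./2 + l.+1 <= i <= n./2 + l.+2)%N ->
    forall l', (0 < l' < n./2)%N -> j = Jseq l' ->
     i <> (n./2 + l')%N :> nat /\ i <> (n./2 + l').+1 :> nat.
  by move=> ni l' _ /Jseq_inj <-; lia.
have hit i : (n./2 + l.+1 <= i <= n./2 + l.+2)%N ->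
    recom j gs i malN = (n./2 - l.+1)%N :> nat.
  move=> hi; rewrite recom_rshift; apply: malicious_attack => //.
  by lia.
have rec i : (n./2 + l <= i)%N -> ~~ (n./2 + l.+1 <= i <= n./2 + l.+2)%N ->
    (n./2 <= recom j gs i (ff i) + l)%N.
  move=> li ni; case: (draw i li) => [->|[i' -> li']].
    by apply: (act i) => //; case: (malicious_rec_generic gs (gen i ni)).
  by rewrite recom_lshift; apply: (act i') => //; exact: Bj_act.
have act' i : (n./2 + l < i)%N ->
    forall k, k \in act_of i (next_gs j gs ff i) -> (n./2 <= k + l.+1)%N.
  move=> li k /(act_next_sub tbP)[/act|->]; first by have := ltnW li; lia.
  case: (boolP (n./2 + l.+1 <= i <= n./2 + l.+2)%N) => hi.
    by rewrite (forced i hi) (hit i hi); lia.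
  by have := rec i (ltnW li) hi; lia.
have best' i (a : 'I_n) : (n./2 + l.+1 <= i <= n./2 + l.+2)%N ->
    a = (n./2 - l.+1)%N :> nat -> a \in act_of i (next_gs j gs ff i).
  move=> hi va; have -> : a = recom j gs i (ff i).
    by apply: val_inj; rewrite /= (forced i hi) (hit i hi).
  exact: recom_in_next.
split=> //.
- move=> i iE k /(act_next_sub tbP)[/act|->]; first by apply; lia.
  by apply: rec; lia.
(* Attacked agents play the received arm most in the next phase, which confirms the recommendation;
   for the others it is generic. *)
- move=> i li; rewrite bu_upd_next // unbl ?(ltnW li) //; case: andP => // -[/eqP mE].
  case: (boolP (n./2 + l.+1 <= i <= n./2 + l.+2)%N) => hi; last first.
    by rewrite -mE; have [_ ->] := malicious_rec_generic gs (gen i hi); rewrite eqxx.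
  have ln : (n./2 - l.+1 < n)%N by lia.
  have := @agent_best l.+1 j.+1 _ i (Ordinal ln) base'; rewrite /next_state => ->.
  + by rewrite -val_eqE /= (forced i hi) (hit i hi) eqxx.
  + by rewrite lh.
  + by rewrite ltnS.
  + by [].
  + exact: best'.
  + exact: act'.
- move=> i i' iE i'E; rewrite bu_upd_next //; have := unbl' i i' iE i'E.
  by rewrite (forced i) ?lshift_neq_mal //; lia.
Qed.

(** Agent h + l + 1 draws agent h + l, is recommended an arm of rank at most [l], but plays the arm
    of rank [l.+1] most. The block, decided in phase [j.+1], lasts until [j.+1 ^ 2 = Jseq l.+2]. *)
Lemma level_block_step l gs : (l.+1 < n./2)%N -> let j := (Jseq l.+1).+1 in
  base_inv j gs -> attacked_inv l j gs ->
  exists (D : {set 'I_n}) (v : 'I_n -> 'I_(n + 1)),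
  [/\ (#|D| <= 1)%N, (forall i, i \in D -> v i \in cand j i (gs i)) &
      forall ff : {ffun 'I_n -> 'I_(n + 1)},
        (forall i, ff i \in cand j i (gs i)) -> (forall i, i \in D -> ff i = v i) ->
        level_inv l.+1 j.+1 (next_gs j gs ff)].
Proof.
move=> lh j base [act0 act unbl best unbl'].
have j0 : (0 < j)%N by [].
have hln : (n./2 + l < n)%N by lia.
pose p : 'I_n := Ordinal hln.
exists [set i : 'I_n | i == (n./2 + l).+1 :> nat].
exists (fun=> lshift 1 p); split.
- case: (ltnP (n./2 + l).+1 n) => lt.
    rewrite (_ : [set _ | _] = [set Ordinal lt]) ?cards1 //.
    by apply/setP => i; rewrite !inE -val_eqE.
  rewrite (_ : [set _ | _] = set0) ?cards0 //.
  by apply/setP => i; rewrite !inE; apply/eqP; have := ltn_ord i; lia.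
(* Any earlier block on agent h + l ended by phase [Jseq l.+1], one phase before this draw. *)
- move=> i; rewrite inE => /eqP iE; apply: unblocked_in_cand.
    by rewrite honest_nbr /= iE eqxx orbT.
  by rewrite ltnS unbl'.
move=> ff ffC ffD.
have base' := base_step ff j0 base.
have forced i : i = (n./2 + l).+1 :> nat -> ff i = lshift 1 p.
  by move=> iE; apply: ffD; rewrite inE iE.
have gen i : forall l', (0 < l' < n./2)%N -> j = Jseq l' ->
     i <> (n./2 + l')%N :> nat /\ i <> (n./2 + l').+1 :> nat.
  move=> l' _; rewrite /j => jJ'; exfalso; have := Jseq_ltS l.+1.
  by case: (leqP l' l.+1) => [/Jseq_le|/Jseq_le]; lia.
have recp i : i = (n./2 + l).+1 :> nat -> (n./2 <= recom j gs i (ff i) + l)%N.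
  move=> iE; rewrite forced // recom_lshift.
  by apply: (act0 p) => //; exact: Bj_act.
have rec i : (n./2 + l.+1 <= i)%N -> (n./2 <= recom j gs i (ff i) + l.+1)%N.
  rewrite addnS => li; have [iE|ni] := eqVneq (i : nat) (n./2 + l).+1.
    by have := recp i iE; lia.
  case: (node_cases (ff i)) => [->|[i' fE]].
    by apply: (act i) => //; case: (malicious_rec_generic gs (gen i)).
  have li' : (n./2 + l < i')%N.
    have := subsetP (cand_sub mu inst_alpha inst_A inst_blockend (@inst_adj n) tb hatS j i (gs i)) _ (ffC i).
    by rewrite fE honest_nbr => /orP[] /eqP; lia.
  by rewrite fE recom_lshift; apply: (act i') => //; exact: Bj_act.
have act' i : (n./2 + l.+1 <= i)%N ->
    forall k, k \in act_of i (next_gs j gs ff i) -> (n./2 <= k + l.+1)%N.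
  move=> li k /(act_next_sub tbP)[/act|->]; last exact: rec.
  by apply; rewrite addnS in li.
have best' i (a : 'I_n) : (n./2 + l.+1 <= i <= n./2 + l.+2)%N ->
    a = (n./2 - l.+1)%N :> nat -> a \in act_of i (next_gs j gs ff i).
  move=> li va; apply: (@best_stays l.+1) => //; [lia|exact: best|].
  by apply: act; lia.
have J2 : Jseq l.+2 = (j.+1 ^ 2)%N by rewrite (@JseqS l.+1) // addn2.
split=> //.
- rewrite addnS => i li; rewrite bu_upd_next // unbl //; case: andP => // -[/eqP mE].
  by rewrite -mE; have [_ ->] := malicious_rec_generic gs (gen i); rewrite eqxx.
- move=> _ i i'; rewrite addnS => iE i'i; rewrite bu_upd_next //.
  have i'p : i' = p by apply: val_inj => /=; lia.
  rewrite forced // i'p eqxx andTb.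
  have ln : (n./2 - l.+1 < n)%N by lia.
  have := @agent_best l.+1 j.+1 _ i (Ordinal ln) base'; rewrite /next_state forced // => ->.
  + have := recp i iE; rewrite forced // => le.
    rewrite ifT; first by rewrite J2 /inst_blockend leq_maxr.
    by rewrite -val_eqE /=; apply/eqP => eqr; move: le; rewrite -eqr; lia.
  + by rewrite lh.
  + by rewrite /j; lia.
  + by [].
  + by have := best' i (Ordinal ln); rewrite /next_state forced //; apply => //; lia.
  + by have := act' i; rewrite /next_state forced //; apply; lia.
(* No block created up to phase [j.+1] outlasts [j.+1 ^ 2], which is exactly the next attack
   phase. *)
- move=> i i' _ _; rewrite J2 -[X in (_ <= X)%N]/(inst_blockend j.+1); have [_ bu] := base' i.
  apply: (bu_upd_le _ _ _ _ _ _ bu).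
  by rewrite /inst_blockend leq_exp2r.
Qed.

End Attack.

(** * Regret bounds *)

Lemma count_le_iota T m d :
  count (fun t => t <= T)%N (iota m.+1 d) = (minn T (m + d) - minn T m)%N.
Proof.
elim: d => [|d IH]; first by rewrite addn0 subnn.
by rewrite -(addn1 d) iotaD count_cat IH /=; lia.
Qed.

Lemma sum_count_phases T J :
  (\sum_(1 <= j < J.+1) count (fun t => t <= T)%N (phase_times inst_A j) = minn T (J ^ 2))%N.
Proof.
elim: J => [|J IH]; first by rewrite big_geq // minn0.
rewrite big_nat_recr //= IH /phase_times count_le_iota /inst_A /=.
have : (J ^ 2 <= J.+1 ^ 2)%N by rewrite leq_exp2r.
by move: (J ^ 2)%N (J.+1 ^ 2)%N => x y; lia.
Qed.

Lemma sum_indicator_le m x : (\sum_(1 <= i < m.+1) (i <= x) = minn m x)%N.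
Proof.
elim: m => [|m IH]; first by rewrite big_geq // min0n.
by rewrite big_nat_recr //= IH; lia.
Qed.

Lemma sum_indicator_eq m x : (\sum_(1 <= i < m.+1) (i == x) <= (x <= m))%N.
Proof.
elim: m => [|m IH]; first by rewrite big_geq.
by rewrite big_nat_recr //=; lia.
Qed.

(* Agents [h] and [h + 1] contact the malicious agent up to phase J_1 = 256; the
   level [l] then prescribes two draws at phase J_l and one at J_l + 1. *)
Definition forced_draws L j : nat :=
  (2 * (j <= 256) + \sum_(1 <= l < L.+1) (2 * (j == Jseq l) + (j == (Jseq l).+1)))%N.

Lemma sum_forced_draws L J : (\sum_(1 <= j < J) forced_draws L j <= 512 + 3 * L)%N.
Proof.
case: J => [|m]; first by rewrite big_geq.
rewrite big_split /= -big_distrr /= sum_indicator_le exchange_big /=.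
have : (\sum_(1 <= l < L.+1) \sum_(1 <= j < m.+1) (2 * (j == Jseq l) + (j == (Jseq l).+1))
    <= \sum_(1 <= l < L.+1) 3)%N.
  apply: leq_sum => l _; rewrite big_split /= -big_distrr /=.
  have := sum_indicator_eq m (Jseq l); have := sum_indicator_eq m (Jseq l).+1.
  by move: (bigop _ _ _) (bigop _ _ _) => x y; lia.
by rewrite sum_nat_const_nat; move: (bigop _ _ _) => x; lia.
Qed.

Lemma forced_draws_attack L l : (l < L)%N ->
  (2 * (Jseq l.+1 <= 256) + 2 <= forced_draws L (Jseq l.+1))%N.
Proof.
move=> lL; rewrite /forced_draws leq_add2l (bigD1_seq l.+1) ?iota_uniq //=.
  by rewrite eqxx; lia.
by rewrite mem_index_iota; lia.
Qed.

Lemma forced_draws_block L l : (l < L)%N -> (1 <= forced_draws L (Jseq l.+1).+1)%N.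
Proof.
move=> lL; rewrite /forced_draws (bigD1_seq l.+1) ?iota_uniq //=.
  by rewrite eqxx; lia.
by rewrite mem_index_iota; lia.
Qed.

Lemma nat_sqrt T : exists J, (J ^ 2 <= T < J.+1 ^ 2)%N.
Proof.
elim: T => [|T [J /andP[le lt]]]; first by exists 0%N.
case: (ltnP T.+1 (J.+1 ^ 2)) => h; first by exists J; rewrite h (leq_trans le).
by exists J.+1; rewrite h /= -mulnn; move: lt h; rewrite -mulnn; lia.
Qed.

(** [L] is the least level whose covered times reach [T]; minimality later bounds [27 ^ L] by a
    power of [ln T]. *)
Lemma attack_level_exists T h : (0 < h)%N -> (T <= Jseq h ^ 2)%N ->
  exists L, [/\ (L < h)%N, (T <= Jseq L.+1 ^ 2)%N & L = 0%N \/ (Jseq L ^ 2 < T)%N].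
Proof.
elim: h => // h IH _ TJ; case: (posnP h) => h0.
  by exists 0%N; rewrite h0 in TJ *; split=> //; left.
case: (leqP T (Jseq h ^ 2)) => lt; last by exists h; split=> //; right.
by have [L [Lh ? ?]] := IH h0 lt; exists L; split=> //; exact: leqW.
Qed.

(** The lower bound on the right side is [(64 * 4) ^ (2 ^ h)], whose factor [64 ^ (2 ^ h)] absorbs
    the probability loss [27 ^ h.-1]. *)
Lemma Jseq_sqr_ge h : (0 < h)%N -> (27 ^ h.-1 * 4 ^ (2 ^ h) <= Jseq h ^ 2)%N.
Proof.
move=> h0; apply: (@leq_trans ((2 ^ (2 ^ (h + 2))) ^ 2)).
  have -> : ((2 ^ (2 ^ (h + 2))) ^ 2 = (64 * 4) ^ (2 ^ h))%N.
    rewrite -[(64 * 4)%N]/(2 ^ 8)%N -!expnM; congr (2 ^ _)%N.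
    by rewrite expnD; move: (2 ^ h)%N => x; lia.
  rewrite expnMn leq_mul2r; apply/orP; right.
  apply: (@leq_trans (64 ^ h.-1)); first by case: (h.-1) => // m; rewrite leq_exp2r.
  by rewrite leq_pexp2l // (leq_trans (leq_pred h)) // ltnW // ltn_expl.
by rewrite leq_exp2r // Jseq_ge.
Qed.

Section Regret.
Context {R : realType} (n : nat).
Hypothesis n4 : (4 <= n)%N.
Hypothesis n_even : ~~ odd n.
Context (tb : {set 'I_n} -> 'I_n).
Hypothesis tbP : forall X : {set 'I_n}, X != set0 -> tb X \in X.
Context (hatS : 'I_n -> {set 'I_n}) (U0 L0 : 'I_n -> 'I_n).
Hypothesis card_hatS : forall i, #|hatS i| = 1%N.
Hypothesis init_bad : forall i : 'I_n, (n./2 <= val i)%N ->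
  forall k : 'I_n, k \in hatS i :|: [set U0 i; L0 i] -> (n./2 <= val k)%N.
Context (a : 'I_n).
Hypothesis aE : val a = n.-1.

Notation mu := (@inst_mu R n).
Notation gap := (@inst_gap R n).
Notation st := (lstate R n (n + 1)).
Notation level_inv := (@level_inv R n tb hatS).
Notation attacked_inv := (@attacked_inv R n tb hatS).
Notation regret T := (@inst_regret R n tb hatS U0 L0 a T).

Lemma hatS_bad (i : 'I_n) : (n./2 <= i)%N -> forall k, k \in hatS i -> (n./2 <= k)%N.
Proof. by move=> hi k kS; apply: (init_bad hi); rewrite inE kS. Qed.

(** The second case isolates the single phase between an attack and the block that follows it. *)
Definition good L j (gs : 'I_n -> st) : Prop :=
  [/\ (0 < j)%N, base_inv j gs &
      (exists l, [/\ (l <= L)%N, (Jseq l < j <= Jseq l.+1)%N & level_inv l j gs]) \/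
      (exists l, [/\ (l < L)%N, j = (Jseq l.+1).+1 & attacked_inv l j gs])].

Lemma base_init : base_inv 1 (@init_state R n 1 n U0 L0).
Proof. by move=> i; split=> k; rewrite /= !ffunE ?mulr0. Qed.

Lemma good_init L : good L 1 (@init_state R n 1 n U0 L0).
Proof.
split=> //; first exact: base_init.
left; exists 0%N; split=> //; split=> //.
- by move=> i hi k kS; rewrite addn0 in hi; rewrite addn0; exact: (init_bad hi kS).
- by move=> i _; rewrite /= ffunE.
- by move=> i i' _ _; rewrite /= ffunE.
Qed.

(** As [n] is even, [a] is agent h + (h - 1), in the range of every level up to [L]; its arms have
    rank below h, which excludes arm 0. *)
Lemma good_gap L j gs k : (L < n./2)%N -> good L j gs -> k \in act_of hatS a (gs a) ->
  1 / 15 <= gap k.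
Proof.
move=> Lh [_ _ []] [l [lL _ []]].
  move=> act _ _ _ _ kS; apply: inst_gap_ge.
  have : (n./2 + l <= a)%N by rewrite -[nat_of_ord a]/(val a) aE; lia.
  by move=> /act/(_ _ kS); lia.
move=> _ act _ _ _ kS; apply: inst_gap_ge.
have : (n./2 + l < a)%N by rewrite -[nat_of_ord a]/(val a) aE; lia.
by move=> /act/(_ _ kS); lia.
Qed.

Lemma good_step L j gs : (L < n./2)%N -> (j < Jseq L.+1)%N -> good L j gs ->
  exists (D : {set 'I_n}) (v : 'I_n -> 'I_(n + 1)),
  [/\ (#|D| <= forced_draws L j)%N,
      (forall i, i \in D -> v i \in
         cand mu inst_alpha inst_A inst_blockend (@inst_adj n) tb hatS j i (gs i)) &
      forall ff : {ffun 'I_n -> 'I_(n + 1)},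
        (forall i, ff i \in
           cand mu inst_alpha inst_A inst_blockend (@inst_adj n) tb hatS j i (gs i)) ->
        (forall i, i \in D -> ff i = v i) ->
        good L j.+1
          (next_state mu inst_alpha inst_A inst_blockend tb hatS (inst_mal tb) j gs ff)].
Proof.
move=> Lh jJ [j0 base [[l [lL /andP[Jj jle] inv]]|[l [lL jE inv]]]].
- move: jle; rewrite leq_eqVlt => /orP[/eqP jE|jlt].
    have {}lL : (l < L)%N.
      by rewrite ltn_neqAle lL andbT; apply/eqP => lE; move: jJ; rewrite jE lE ltnn.
    rewrite jE in j0 base inv *.
    have [|D [v [Dc vC st]]] := level_attack_step n4 tbP card_hatS _ base inv.
      exact: leq_ltn_trans lL Lh.
    exists D, v; split=> //; first exact: leq_trans Dc (forced_draws_attack lL).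
    move=> ff ffC ffD; split=> //; first exact: base_step.
    by right; exists l; split=> //; exact: st.
  have lJ : (Jseq l < j < Jseq l.+1)%N by rewrite Jj.
  have [D [v [Dc vC st]]] :=
    level_window_step n4 tbP card_hatS hatS_bad (leq_ltn_trans lL Lh) lJ base inv.
  exists D, v; split=> //; first by apply: (leq_trans Dc); exact: leq_addr.
  move=> ff ffC ffD; split=> //; first exact: base_step.
  by left; exists l; split=> //; [rewrite ltnS (ltnW Jj) | exact: st].
- rewrite jE in j0 base inv *.
  have [|D [v [Dc vC st]]] := level_block_step n4 tbP card_hatS hatS_bad _ base inv.
    exact: leq_ltn_trans lL Lh.
  exists D, v; split=> //; first exact: leq_trans Dc (forced_draws_block lL).
  move=> ff ffC ffD; split=> //; first exact: base_step.
  left; exists l.+1; split=> //; last exact: st.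
  by have := Jseq_ltS l.+1; lia.
Qed.

Lemma regret_attack L T : (L < n./2)%N ->
  ((3 ^ (512 + 3 * L))%:R)^-1 * (1 / 15 * (minn T (Jseq L.+1 ^ 2))%:R) <= regret T.
Proof.
(* Fuel [T] reaches phase [T.+1] only; phases up to there contain all times up to [T]. *)
move=> Lh; pose J := minn (Jseq L.+1) T.+1.
have JJ : (J <= Jseq L.+1)%N by exact: geq_minl.
have J0 : (0 < J)%N by rewrite leq_min ltnS leq0n andbT; have := Jseq_ltS L; lia.
have JT : (J <= 1 + T)%N by exact: geq_minr.
pose cost j : R := 1 / 15 * (count (fun t => t <= T)%N (phase_times inst_A j))%:R.
have gap0 : forall k, 0 <= gap k by exact: inst_gap_ge0.
have := @exp_cost_forced R n 1 n mu gap inst_alpha inst_A inst_blockend (@inst_adj n) tb hatS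
  (inst_mal tb) (@nbrs_neq0 n) gap0 (good L) 3 (forced_draws L) cost T a J isT (@card_nbrs n).
move=> /(_ _ _ _ T 1 _ (good_init L)) H.
apply: le_trans (H _ _ _ _).
- rewrite /cost -big_distrr /= -natr_sum sum_count_phases.
  apply: ler_pM.
  + by rewrite invr_ge0 ler0n.
  + by apply: mulr_ge0 => //; lra.
  + by rewrite lef_pV2 ?posrE ?ltr0n ?expn_gt0 // ler_nat leq_pexp2l // sum_forced_draws.
  + rewrite ler_wpM2l //; first lra.
    rewrite ler_nat /J; case: (leqP (Jseq L.+1) T.+1) => // _.
    by rewrite (leq_trans (geq_minl _ _)) // leq_min leqnn -mulnn; lia.
- by move=> j; rewrite /cost mulr_ge0 //; lra.
- move=> j gs _ gd; apply: phase_cost_ge_const => //; first exact: act_neq0.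
  by move=> k; exact: (good_gap Lh gd).
- by move=> j gs jJ; apply: good_step => //; exact: leq_trans JJ.
- by rewrite J0 JT.
Qed.

(** The sticky arm [s] has gap 1; its count is the potential and reaches [ln J] by the end of phase
    [J]. *)
Lemma regret_ln T : (256 ^ 2 <= T)%N -> ln (T%:R : R) / 4 <= regret T.
Proof.
(* [J] is the last phase ending by time [T]; [T < J.+1 ^ 2 <= J ^ 4] gives the factor 4 between the
   logarithms. *)
move=> T256; have [J /andP[JT TJ]] := nat_sqrt T.
have J256 : (256 <= J)%N.
  by rewrite -ltnS -(ltn_exp2r _ _ (isT : 0 < 2)%N); exact: leq_ltn_trans TJ.
have ah : (n./2 <= a)%N by rewrite -[nat_of_ord a]/(val a) aE; lia.
have [s sS] : exists s, s \in hatS a by apply/set0Pn; rewrite -card_gt0 card_hatS.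
have gs1 : gap s = 1 by apply: inst_gap_bad => //; exact: hatS_bad ah _ sS.
have gap0 : forall k, 0 <= gap k by exact: inst_gap_ge0.
pose pot (gs : 'I_n -> st) : R := (l_cnt (gs a) s)%:R.
pose Base j (gs : 'I_n -> st) := (0 < j)%N /\ base_inv j gs.
have times j : (0 < j)%N -> (j <= J)%N -> forall t, t \in phase_times inst_A j -> (t <= T)%N.
  move=> j0 jJ t /(mem_phase_times j0)/andP[_ tj].
  by rewrite (leq_trans tj) // (leq_trans _ JT) // leq_exp2r.
have := @exp_cost_potential R n 1 n mu gap inst_alpha inst_A inst_blockend (@inst_adj n) tb hatS
  (inst_mal tb) (@nbrs_neq0 n) gap0 Base pot (ln J%:R) T a J.
move=> /(_ _ _ T 1 (@init_state R n 1 n U0 L0) _ _) H.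
have lnJ : ln (T%:R : R) <= 4 * ln (J%:R : R).
  have J0 : 0 < J%:R :> R by rewrite ltr0n; exact: leq_trans J256.
  have <- : ln ((J%:R : R) ^+ 4) = 4 * ln J%:R by rewrite lnXn // mulr_natl.
  rewrite ler_ln ?posrE ?exprn_gt0 //; last by rewrite ltr0n; exact: leq_trans T256.
  rewrite -natrX ler_nat (leq_trans (ltnW TJ)) // -[4%N]/(2 * 2)%N expnM leq_exp2r //.
  by rewrite -mulnn; nia.
apply: (@le_trans _ _ (ln J%:R)); first lra.
apply: le_trans (H _ _ _ _).
- by rewrite /pot /= ffunE subr0.
- move=> j gs ff jJ [j0 base]; split; first by split=> //; exact: base_step.
  rewrite /pot /next_state cnt_next; apply: phase_cost_ge_count => //.
  exact: times j0 (ltnW jJ).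
- move=> gs [j0 base]; rewrite /pot.
  apply: (@le_trans _ _ ((phase_out mu inst_alpha inst_A tb hatS J a (gs a)).1.2 s)%:R).
    have [mean _] := base a; apply: sticky_pulls => //; first exact: card_act.
    exact: (subsetP (hatS_act hatS a (gs a))).
  by apply: phase_cost_ge_count => //; exact: times.
- by split=> //; exact: base_init.
- rewrite (leq_trans _ J256) //= add1n.
  by apply: leq_trans (leqW JT); rewrite -mulnn; nia.
Qed.

End Regret.

(** * Combining the two regret bounds *)

Definition attack_const (R : realType) : R := (3 ^+ 512)^-1 / 15.

Lemma attack_const_bounds (R : realType) : 0 < attack_const R <= 1.
Proof.
rewrite /attack_const; move: 512%N => N.
have N1 : 1 <= 3 ^+ N :> R by rewrite exprn_ege1 //; lra.
have N0 : 0 < 3 ^+ N :> R by exact: lt_le_trans N1.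
have /andP[i0 i1] : 0 < (3 ^+ N : R)^-1 <= 1 by rewrite invr_gt0 N0 invf_le1.
by apply/andP; split; lra.
Qed.

(** The exponent 512 counts two draws in each of the first 256 phases, [27 ^ L] three draws per
    level, and [1 / 15] bounds the gaps from below. *)
Lemma attack_const_split (R : realType) L (x : R) :
  ((3 ^ (512 + 3 * L))%:R)^-1 * (1 / 15 * x) = attack_const R / (27 ^ L)%:R * x.
Proof.
rewrite /attack_const; move: 512%N => N.
rewrite expnD natrM expnM -[(3 ^ 3)%N]/27%N natrX invfM.
by rewrite mul1r -!mulrA; congr (_ * _); rewrite mulrCA.
Qed.

(** [expR (2 / 3) <= 2] bounds the inner exponential by [2 ^ h], and [expR 1 <= 4] the outer one by
    [4 ^ (2 ^ h)]. *)
Lemma expR_expR_le (R : realType) h : (0 < h)%N ->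
  expR (expR ((h + h)%:R / 3)) <= (Jseq h ^ 2)%:R / (27 ^ h.-1)%:R :> R.
Proof.
move=> h0; rewrite ler_pdivlMr ?ltr0n ?expn_gt0 // mulrC.
apply: (@le_trans _ _ ((27 ^ h.-1 * 4 ^ (2 ^ h))%:R)); last by rewrite ler_nat Jseq_sqr_ge.
rewrite natrM ler_wpM2l // natrX.
have e4 : expR 1 <= 4 :> R.
  apply: (@le_trans _ _ (expR (2 / 3 * 2%:R))); first by rewrite ler_expR; lra.
  rewrite expRM_natr (_ : 4 = 2 ^+ 2); last by ring.
  by rewrite ler_pXn2r ?nnegrE ?expR_ge0 ?expR_2d3_le //; lra.
apply: (@le_trans _ _ (expR ((2 ^ h)%:R))); last first.
  rewrite -[X in expR X]mul1r expRM_natr ler_pXn2r ?nnegrE ?expR_ge0 ?expn_gt0 //.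
rewrite ler_expR (_ : (h + h)%:R / 3 = 2 / 3 * h%:R); last by rewrite natrD; lra.
by rewrite expRM_natr natrX ler_pXn2r ?nnegrE ?expR_ge0 ?expR_2d3_le //; lra.
Qed.

(** The power 7 comes from [27 <= 2 ^ 7] and [2 ^ L <= ln T]; the factor 32 covers [L = 0], where
    [ln T] can be as small as [ln 2]. *)
Lemma level_le_ln (R : realType) L T : (2 <= T)%N -> L = 0%N \/ (Jseq L ^ 2 < T)%N ->
  (27 ^ L)%:R <= 32 * ln (T%:R : R) ^+ 7.
Proof.
move=> T2 LT.
have T0 : 0 < T%:R :> R by rewrite ltr0n; exact: leq_trans T2.
have := @ln2_ge R => l2.
case: (posnP L) LT => [-> _|L0 [L0'|lt]]; [|by rewrite L0' in L0|].
  have lT : 2 / 3 <= ln (T%:R : R).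
    by apply: (le_trans l2); rewrite ler_ln ?posrE // ?ler_nat //; lra.
  have : (2 / 3 : R) ^+ 7 <= ln (T%:R : R) ^+ 7.
    by rewrite ler_pXn2r ?nnegrE //; lra.
  by rewrite expn0; lra.
have lT : (2 ^ L)%:R <= ln (T%:R : R).
  have le : (2 ^ (2 ^ L * 2) <= T)%N.
    apply: leq_trans (ltnW lt); rewrite expnM leq_exp2r //.
    apply: leq_trans (Jseq_ge L0); rewrite leq_pexp2l // leq_pexp2l //.
    exact: leq_addr.
  have : ln ((2 ^ (2 ^ L * 2))%:R : R) <= ln (T%:R : R).
    by rewrite ler_ln ?posrE ?ltr0n ?expn_gt0 // ?ler_nat // -(ltr0n R).
  rewrite natrX lnXn; last by lra.
  rewrite mulrnA -(mulr_natr (ln 2)); set y : R := (2 ^ L)%:R.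
  have y0 : 0 <= y by exact: ler0n.
  by rewrite mulr2n; nra.
have : ((2 ^ L)%:R : R) ^+ 7 <= ln (T%:R : R) ^+ 7.
  by rewrite ler_pXn2r ?nnegrE // (le_trans _ lT).
have : (27 ^ L)%:R <= ((2 ^ L)%:R : R) ^+ 7.
  rewrite -natrX ler_nat -expnM mulnC expnM.
  by case: (L) => // m; rewrite leq_exp2r.
have : 0 <= (27 ^ L)%:R :> R by exact: ler0n.
by set x := (27 ^ L)%:R; lra.
Qed.

Theorem theorem1 :
  forall R : realType, exists c : R, 0 < c /\
  forall n : nat, (4 <= n)%N -> ~~ odd n ->
  forall (tb : {set 'I_n} -> 'I_n),
    (forall X : {set 'I_n}, X != set0 -> tb X \in X) ->
  forall (hatS : 'I_n -> {set 'I_n}) (U0 L0 : 'I_n -> 'I_n),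
    (forall i, #|hatS i| = 1%N) ->
    (forall i, U0 i \notin hatS i) ->
    (forall i, L0 i \notin hatS i) ->
    (forall i, U0 i != L0 i) ->
    (forall i : 'I_n, (n./2 <= val i)%N ->
       forall k : 'I_n, k \in hatS i :|: [set U0 i; L0 i] -> (n./2 <= val k)%N) ->
  forall a : 'I_n, val a = n.-1 ->
  forall T : nat, (2 <= T)%N ->
    c * Num.min (ln (T%:R : R) + expR (expR (n%:R / 3%:R)))
                ((T%:R : R) / (ln (T%:R : R)) ^+ 7)
    <= inst_regret tb hatS U0 L0 a T.
Proof.
move=> R; exists (attack_const R / 32).
have /andP[q0 q1] := attack_const_bounds R; split; first by lra.
move=> n n4 n_even tb tbP hatS U0 L0 cS _ _ _ bad a aE T T2.
have attack L := @regret_attack R n n4 n_even tb tbP hatS U0 L0 cS bad a aE L T.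
have logT := @regret_ln R n n4 n_even tb tbP hatS U0 L0 cS bad a aE T.
move: attack logT; set P := inst_regret _ _ _ _ _ _ => attack logT.
set q := attack_const R in q0 q1 *.
have {}attack L : (L < n./2)%N -> q / (27 ^ L)%:R * (minn T (Jseq L.+1 ^ 2))%:R <= P.
  by move=> /attack; rewrite attack_const_split.
have h0 : (0 < n./2)%N by lia.
have T0 : 0 < T%:R :> R by rewrite ltr0n; exact: leq_trans T2.
have T1 : 1 < T%:R :> R by rewrite ltr1n.
have lnT0 : 0 < ln (T%:R : R) by rewrite ln_gt0.
(* For small [T] level 0 covers the whole horizon, and its cost, linear in [T], dominates [ln T]. *)
have lnP : q / 4 * ln T%:R <= P.
  case: (leqP (256 ^ 2) T) => [/logT le|lt]; first by apply: le_trans le; nra.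
  apply: le_trans (attack 0%N h0); rewrite Jseq1 (minn_idPl (ltnW lt)) expn0 invr1 mulr1.
  have : ln (T%:R : R) <= T%:R.
    have := @le_ln1Dx R (T%:R - 1); rewrite (_ : 1 + (T%:R - 1) = T%:R); last by ring.
    by move=> /(_ ltac:(lra)); lra.
  by nra.
(* Beyond this horizon the highest level h - 1 gives the double exponential; below it, the level
   adapted to [T] gives the quotient by [ln T ^+ 7]. *)
case: (leqP (Jseq n./2 ^ 2) T) => lt.
  have EP : q * expR (expR (n%:R / 3)) <= P.
    have hP : n./2.-1.+1 = n./2 by rewrite prednK.
    apply: (@le_trans _ _ (q / (27 ^ n./2.-1)%:R * (Jseq n./2 ^ 2)%:R)).
      rewrite -mulrA ler_pM2l // [X in _ <= X]mulrC.
      have {1}-> : n = (n./2 + n./2)%N by rewrite addnn even_halfK.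
      exact: expR_expR_le.
    have := attack n./2.-1; rewrite hP => /(_ (leqnn _)).
    by rewrite (minn_idPr lt).
  apply: (@le_trans _ _ (q / 32 * (ln T%:R + expR (expR (n%:R / 3))))).
    by rewrite ler_pM2l ?ge_min ?lexx //; lra.
  have := expR_gt0 (expR (n%:R / 3) : R).
  set E := expR (expR _) in EP *; nra.
have [L [Lh TJ LT]] := attack_level_exists h0 (ltnW lt).
have := attack L Lh; rewrite (minn_idPl TJ); apply: le_trans.
apply: (@le_trans _ _ (q / 32 * (T%:R / ln T%:R ^+ 7))).
  by rewrite ler_pM2l ?ge_min ?lexx ?orbT //; lra.
have := level_le_ln R T2 LT; set x := ln _ ^+ 7; set y := (27 ^ L)%:R => yx.
have x0 : 0 < x by rewrite exprn_gt0.
have y0 : 0 < y :> R by rewrite ltr0n expn_gt0.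
rewrite mulrA mulrAC ler_pM2r // -mulrA ler_pM2l // -invfM lef_pV2 ?posrE //.
by rewrite mulr_gt0.
Qed.
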